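(* Let $G$ be a finite group and let $R$ be a commutative Frobenius $\star$-algebra over $\mathbb{C}$ equipped with an action of $G$ by Frobenius $\star$-algebra automorphisms. Then there is a bijective correspondence between the set $\operatorname{Frob}(G,R)$ of isomorphism classes of strict $G$-crossed extensions of $R$ and the second group cohomology $H^{2}(G,R^{\times})$ of $G$ with coefficients in the $G$-module $R^\times$ of units of $R$: $$\operatorname{Frob}(G,R)\longleftrightarrow H^{2}(G,R^{\times}).$$
   Context: All algebras are over $\mathbb{C}$. A Frobenius $\star$-algebra is a finite-dimensional associative unital $\mathbb{C}$-algebra $A$ with a linear functional $\lambda:A\to\mathbb{C}$ satisfying $\lambda(ab)=\lambda(ba)$ (a class functional) and a map $\star:A\to A$ which is additive, conjugate-linear, involutive ($(a^\star)^\star=a$), anti-multiplicative ($(ab)^\star=b^\star a^\star$), satisfies $\lambda(a^\star)=\overline{\lambda(a)}$, and such that the Hermitian form $\langle a,b\rangle=\lambda(ab^\star)$ is positive definite. A homomorphism of Frobenius $\star$-algebras is an algebra homomorphism compatible with $\lambda$ and $\star$. A $G$-graded Frobenius $\star$-algebra is a $G$-graded finite-dimensional unital algebra $A=\bigoplus_{g\in G}A_g$ with a semilinear anti-involution $\star$ and a class functional $\lambda_0:A_1\to\mathbb{C}$, extended to $\lambda:A\to\mathbb{C}$ by zero on $A_g$, $g\neq1$, such that $(A,\lambda,\star)$ is a Frobenius $\star$-algebra and $(A_g)^\star=A_{g^{-1}}$. A $G$-crossed Frobenius $\star$-algebra is a $G$-graded Frobenius $\star$-algebra $A$ with an action of $G$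 by Frobenius $\star$-algebra automorphisms such that $g(A_h)\subseteq A_{ghg^{-1}}$ for all $g,h\in G$, and $ab=g(b)a$ for all $a\in A_g$, $b\in A$. Then $A_1$ is commutative and stable under $G$. Let $\operatorname{Sim}(A_1)$ be the set of algebra homomorphisms $\chi:A_1\to\mathbb{C}$ (identified with simple $A_1$-modules up to isomorphism). $G$ acts on it by ${}^g\chi=\chi\circ g^{-1}$. There is also a partial action: for a simple $A_1$-module $M$ and $g\in G$, ${}^gM=(A\otimes_{A_1}M)_g=A_g\otimes_{A_1}M$, which is either $0$ or a simple $A_1$-module; $M$ is fixed by the partial action of $g$ if ${}^gM\cong M$. $A$ is strict if for each $g\in G$ the set of fixed points of the partial action of $g$ on $\operatorname{Sim}(A_1)$ equals the set of fixed points of the action $\chi\mapsto\chi\circ g^{-1}$. A (strict) $G$-crossed extension of $R$ is a pair $(A,j)$ where $A$ is a (strict) $G$-crossed Frobenius $\star$-algebra and $j:R\hookrightarrow A$ is a Frobenius $\star$-algebra embedding with $j(R)=A_1$ such that the $G$-action on $A_1=j(R)$ agrees with the given action on $R$. An isomorphism $(A,j)\to(A',j')$ is an isomorphism of Frobenius $\star$-algebras $f:A\to A'$ that preserves the grading, commutes with the $G$-actions, and satisfies $f\circ j=j'$ (i.e. is the identity on the trivial component $R$). *)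

(* Defs.v *)
From HB Require Import structures.
From mathcomp Require Import all_boot all_order all_algebra all_fingroup.
From mathcomp Require Export complex.
From mathcomp Require Import boolp classical_sets.
From mathcomp Require Export reals.

Set Implicit Arguments.
Unset Strict Implicit.
Unset Printing Implicit Defensive.

Import Order.TTheory GRing.Theory Num.Theory.
Local Open Scope ring_scope.

(* Finite-dimensional associative unital algebras. falgType is not used because
   its instances are nonzero rings; here the zero algebra is allowed. *)
Record fdAlg (C : numClosedFieldType) := FdAlg {
  fd_space : vectType C;
  fd_one : fd_space;
  fd_mul : fd_space -> fd_space -> fd_space;
  fd_mulA : associative fd_mul;
  fd_mul1l : left_id fd_one fd_mul;
  fd_mul1r : right_id fd_one fd_mul;
  fd_mulDl : left_distributive fd_mul +%R;
  fd_mulDr : right_distributive fd_mul +%R;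
  fd_scaleAl : forall (c : C) a b, c *: fd_mul a b = fd_mul (c *: a) b;
  fd_scaleAr : forall (c : C) a b, c *: fd_mul a b = fd_mul a (c *: b)
}.

Definition fd_sort (C : numClosedFieldType) (A : fdAlg C) : Type := fd_space A.
Coercion fd_sort : fdAlg >-> Sortclass.

HB.instance Definition _ (C : numClosedFieldType) (A : fdAlg C) :=
  Vector.copy (fd_sort A) (fd_space A).
HB.instance Definition _ (C : numClosedFieldType) (A : fdAlg C) :=
  GRing.Zmodule_isPzRing.Build (fd_sort A) (@fd_mulA C A) (@fd_mul1l C A)
    (@fd_mul1r C A) (@fd_mulDl C A) (@fd_mulDr C A).

Record frobStarAlg (C : numClosedFieldType) := FrobStarAlg {
  fs_alg :> fdAlg C;
  lambda : {scalar fs_alg};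
  star : fs_alg -> fs_alg;
  lambda_class : forall a b, lambda (a * b) = lambda (b * a);
  starD : forall a b, star (a + b) = star a + star b;
  starZ : forall (c : C) a, star (c *: a) = c^* *: star a;
  starK : involutive star;
  starM : forall a b, star (a * b) = star b * star a;
  lambda_star : forall a, lambda (star a) = (lambda a)^*;
  form_posdef : forall a, a != 0 -> 0 < lambda (a * star a)
}.

Arguments lambda {C f}.

Definition frob_hom (C : numClosedFieldType) (A B : frobStarAlg C)
    (f : A -> B) : Prop :=
  [/\ linear f, monoid_morphism f,
      forall a, lambda (f a) = lambda a &
      forall a, f (star a) = star (f a)].

(* Left actions; each [gact g] is invertible by [gact1] and [gactM]. *)
Record frobAction (G : finGroupType) (C : numClosedFieldType)
    (A : frobStarAlg C) := FrobAction {
  gact :> G -> A -> A;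
  gact_hom : forall g, frob_hom (gact g);
  gact1 : forall a, gact 1%g a = a;
  gactM : forall g h a, gact (g * h)%g a = gact g (gact h a)
}.

(* A class functional on the component A_1 extended by zero is a class
   functional on A vanishing on A_g for g != 1: traciality of the extension is
   part of A being a Frobenius star-algebra. *)
Record gradedFrob (G : finGroupType) (C : numClosedFieldType) := GradedFrob {
  gf_alg :> frobStarAlg C;
  hcomp : G -> {vspace gf_alg};
  comp_full : (\sum_(g : G) hcomp g)%VS = fullv;
  comp_direct : directv (\sum_(g : G) hcomp g);
  comp_one : 1 \in hcomp 1%g;
  comp_mul : forall g h a b,
    a \in hcomp g -> b \in hcomp h -> a * b \in hcomp (g * h)%g;
  comp_lambda : forall g a, g != 1%g -> a \in hcomp g -> lambda a = 0;
  comp_star : forall g b,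
    b \in hcomp g^-1%g <-> exists2 a, a \in hcomp g & b = star a
}.

Record crossedFrob (G : finGroupType) (C : numClosedFieldType) := CrossedFrob {
  cf_graded :> gradedFrob G C;
  cact : frobAction G cf_graded;
  cact_comp : forall g h a,
    a \in hcomp cf_graded h -> cact g a \in hcomp cf_graded (g * h * g^-1)%g;
  cact_cross : forall g a b,
    a \in hcomp cf_graded g -> a * b = cact g b * a
}.

Section TrivialComponent.
Variables (G : finGroupType) (C : numClosedFieldType) (A : gradedFrob G C).

Lemma comp1_mul (x y : subvs_of (hcomp A 1%g)) :
  vsval x * vsval y \in hcomp A 1%g.
Proof. by have := comp_mul (subvsP x) (subvsP y); rewrite mulg1. Qed.

Lemma comp1_mull g (x : subvs_of (hcomp A 1%g)) (y : subvs_of (hcomp A g)) :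
  vsval x * vsval y \in hcomp A g.
Proof. by have := comp_mul (subvsP x) (subvsP y); rewrite mul1g. Qed.

Lemma comp1_mulr g (x : subvs_of (hcomp A g)) (y : subvs_of (hcomp A 1%g)) :
  vsval x * vsval y \in hcomp A g.
Proof. by have := comp_mul (subvsP x) (subvsP y); rewrite mulg1. Qed.

Definition one1 : subvs_of (hcomp A 1%g) := Subvs (comp_one A).
Definition mul1 (x y : subvs_of (hcomp A 1%g)) : subvs_of (hcomp A 1%g) :=
  Subvs (comp1_mul x y).

Lemma mul1A : associative mul1.
Proof. by move=> x y z; apply: val_inj; rewrite /= mulrA. Qed.
Lemma mul1_1l : left_id one1 mul1.
Proof. by move=> x; apply: val_inj; rewrite /= mul1r. Qed.
Lemma mul1_1r : right_id one1 mul1.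
Proof. by move=> x; apply: val_inj; rewrite /= mulr1. Qed.
Lemma mul1Dl : left_distributive mul1 +%R.
Proof. by move=> x y z; apply: val_inj; rewrite /= mulrDl. Qed.
Lemma mul1Dr : right_distributive mul1 +%R.
Proof. by move=> x y z; apply: val_inj; rewrite /= mulrDr. Qed.
Lemma scale1Al (c : C) x y : c *: mul1 x y = mul1 (c *: x) y.
Proof. by apply: val_inj; apply: fd_scaleAl. Qed.
Lemma scale1Ar (c : C) x y : c *: mul1 x y = mul1 x (c *: y).
Proof. by apply: val_inj; apply: fd_scaleAr. Qed.

Definition comp1 : fdAlg C :=
  FdAlg mul1A mul1_1l mul1_1r mul1Dl mul1Dr scale1Al scale1Ar.

Definition comp_lact g (r : comp1) (x : subvs_of (hcomp A g)) :
  subvs_of (hcomp A g) := Subvs (comp1_mull r x).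
Definition comp_ract g (x : subvs_of (hcomp A g)) (r : comp1) :
  subvs_of (hcomp A g) := Subvs (comp1_mulr x r).

End TrivialComponent.

Record sim (C : numClosedFieldType) (B : fdAlg C) := Sim {
  chi :> B -> C;
  chi_linear : scalar chi;
  chi_monoid : monoid_morphism chi
}.

(* The simple module attached to a character: C with r acting as chi r. *)
Definition sim_mod (C : numClosedFieldType) (B : fdAlg C) (x : sim B) : Type :=
  C.

HB.instance Definition _ (C : numClosedFieldType) (B : fdAlg C) (x : sim B) :=
  GRing.Zmodule.copy (sim_mod x) C.

Section SimModule.
Variables (C : numClosedFieldType) (B : fdAlg C) (x : sim B).

Definition sim_scale (r : B) (z : sim_mod x) : sim_mod x := (x r * z : C).

Lemma sim_scaleA r s z : sim_scale r (sim_scale s z) = sim_scale (r * s) z.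
Proof. by rewrite /sim_scale (chi_monoid x).2 mulrA. Qed.
Lemma sim_scale1 : left_id 1 sim_scale.
Proof. by move=> z; rewrite /sim_scale (chi_monoid x).1 mul1r. Qed.
Lemma sim_scaleDr : right_distributive sim_scale +%R.
Proof. by move=> r u v; apply: (@mulrDr C). Qed.
Lemma sim_scaleDl z : {morph sim_scale^~ z : r s / r + s}.
Proof.
move=> r s; rewrite /sim_scale.
by have := chi_linear x 1 r s; rewrite scale1r mul1r => ->; apply: (@mulrDl C).
Qed.

End SimModule.

HB.instance Definition _ (C : numClosedFieldType) (B : fdAlg C) (x : sim B) :=
  GRing.Zmodule_isLmodule.Build B (sim_mod x) (@sim_scaleA C B x)
    (@sim_scale1 C B x) (@sim_scaleDr C B x) (@sim_scaleDl C B x).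

Definition balanced (B : pzRingType) (X : zmodType) (ract : X -> B -> X)
    (M : lmodType B) (T : zmodType) (t : X -> M -> T) : Prop :=
  [/\ forall x y m, t (x + y) m = t x m + t y m,
      forall x m n, t x (m + n) = t x m + t x n &
      forall x r m, t (ract x r) m = t x (r *: m)].

(* [t] exhibits the abelian group T as the tensor product over B of the right
   B-module X, with action [ract], and the left B-module M. *)
Definition is_tensor (B : pzRingType) (X : zmodType) (ract : X -> B -> X)
    (M : lmodType B) (T : zmodType) (t : X -> M -> T) : Prop :=
  balanced ract t /\
  forall (Z : zmodType) (u : X -> M -> Z), balanced ract u ->
    exists2 f : {additive T -> Z}, forall x m, f (t x m) = u x m &
      forall f' : {additive T -> Z},
        (forall x m, f' (t x m) = u x m) -> f' =1 f.

Section PartialAction.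
Variables (G : finGroupType) (C : numClosedFieldType) (A : gradedFrob G C).

(* T is A_g tensored over A_1 with M, as a left A_1-module. *)
Definition is_translate (g : G) (M T : lmodType (comp1 A)) : Prop :=
  exists2 t : subvs_of (hcomp A g) -> M -> T,
    is_tensor (@comp_ract G C A g) t &
    forall r x m, t (comp_lact r x) m = r *: t x m.

Definition partial_fixed (g : G) (x : sim (comp1 A)) : Prop :=
  exists2 T : lmodType (comp1 A), is_translate g (sim_mod x) T &
    exists f : {linear T -> sim_mod x}, bijective f.

End PartialAction.

Section Strict.
Variables (G : finGroupType) (C : numClosedFieldType) (A : crossedFrob G C).

Lemma cact_comp1 g (x : comp1 A) : cact A g (vsval x) \in hcomp A 1%g.
Proof. by have := cact_comp g (subvsP x); rewrite mulg1 mulgV. Qed.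

Definition cact1 (g : G) (x : comp1 A) : comp1 A := Subvs (cact_comp1 g x).

Definition action_fixed (g : G) (x : sim (comp1 A)) : Prop :=
  forall r, x (cact1 g^-1%g r) = x r.

Definition strict : Prop :=
  forall (g : G) (x : sim (comp1 A)), partial_fixed g x <-> action_fixed g x.

End Strict.

Record crossedExt (G : finGroupType) (C : numClosedFieldType)
    (R : frobStarAlg C) (rho : frobAction G R) := CrossedExt {
  ext_alg :> crossedFrob G C;
  ext_emb : R -> ext_alg;
  ext_emb_hom : frob_hom ext_emb;
  ext_emb_inj : injective ext_emb;
  ext_emb_im : forall a, a \in hcomp ext_alg 1%g <-> exists r, a = ext_emb r;
  ext_emb_act : forall g r, cact ext_alg g (ext_emb r) = ext_emb (rho g r)
}.

Definition ext_iso (G : finGroupType) (C : numClosedFieldType)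
    (R : frobStarAlg C) (rho : frobAction G R) (E E' : crossedExt rho) : Prop :=
  exists f : E -> E',
    [/\ frob_hom f /\ bijective f,
        forall g a, a \in hcomp E g -> f a \in hcomp E' g,
        forall g a, f (cact E g a) = cact E' g (f a) &
        forall r, f (ext_emb E r) = ext_emb E' r].

Record strictExt (G : finGroupType) (C : numClosedFieldType)
    (R : frobStarAlg C) (rho : frobAction G R) := StrictExt {
  strict_ext :> crossedExt rho;
  strict_extP : strict strict_ext
}.

(* Frob(G, R): isomorphism classes, as sets of extensions. [set] lives in too
   small a universe to be applied to [strictExt rho]. *)
Definition Frob (G : finGroupType) (C : numClosedFieldType)
    (R : frobStarAlg C) (rho : frobAction G R) : Type :=
  {S : strictExt rho -> Prop |
    exists E : strictExt rho, S = fun E' => ext_iso E E'}.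

Section Cohomology.
Variables (G : finGroupType) (C : numClosedFieldType) (R : frobStarAlg C).
Variable rho : frobAction G R.

Definition is_unit (r : R) : Prop := exists s, r * s = 1 /\ s * r = 1.

Definition cocycle2 (c : G -> G -> R) : Prop :=
  (forall g h, is_unit (c g h)) /\
  forall g h k, rho g (c h k) * c g (h * k)%g = c (g * h)%g k * c g h.

(* b is the coboundary of a 1-cochain u in the units:
   b g h = u g * rho g (u h) / u (g h). *)
Definition coboundary2 (b : G -> G -> R) : Prop :=
  exists2 u : G -> R, forall g, is_unit (u g) &
    forall g h, b g h * u (g * h)%g = u g * rho g (u h).

(* H^2(G, R^x): the cosets of 2-coboundaries in the group of 2-cocycles. *)
Definition H2 : Type :=
  {S : set (G -> G -> R) |
    exists2 c, cocycle2 c &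
      S = [set c' | exists2 b, coboundary2 b &
                    forall g h, c' g h = c g h * b g h]%classic}.

End Cohomology.

(* Main.v *)
(** Positivity makes [R] a product of copies of [C], with primitive idempotents
    [e_i] permuted by [G].  In an extension [A] the algebra [R] is central, so
    [e_i A_g] vanishes unless [g] fixes [i], and positivity makes it at most a
    line; strictness says that it is a line whenever [g] fixes [i].

    A cocycle [c] yields the centraliser of [R] in the crossed product
    [\bigoplus_g R w_g] twisted by [c], on which [g] acts as conjugation by
    [w_g].  For the star structure one first makes [c] unitary and normalised:
    [|c|] is a coboundary, by taking the [#|G|]-th root of a product over [G].
    Conversely, choosing generators of the lines over one point in each orbit
    and transporting them by a transversal gives [A] the structure constants
    of such a centraliser, for a cocycle that is unique up to coboundaries by
    Shapiro's lemma.  An algebra isomorphism that matches such generators is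
    automatically compatible with the star operations, because the norms of
    two families of generators differ by a homomorphism from a finite
    stabiliser to the positive reals. *)
From HB Require Import structures.
Require Import Defs.
From mathcomp Require Import all_boot all_order all_algebra all_fingroup.
From mathcomp Require Import ring spectral boolp classical_sets.

Set Implicit Arguments.
Unset Strict Implicit.
Unset Printing Implicit Defensive.

Import Order.TTheory GRing.Theory Num.Theory VectorInternalTheory.
Local Open Scope ring_scope.

(** * Primitive idempotents *)

(** In coordinates [f] is a square matrix of positive size over an algebraically closed field, which
    has an eigenvalue. *)
Lemma eigenvector_exists (C : numClosedFieldType) (V : vectType C)
    (f : {linear V -> V}) :
  (0 < dim V)%N -> exists a v, v != 0 /\ f v = a *: v.
Proof.
move=> V_gt0.
pose F (u : 'rV[C]_(dim V)) := v2r (f (r2v u)).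
have F_lin : linear F by move=> a u v; rewrite /F !linearP.
pose Fl : {linear _ -> _} :=
  HB.pack F (GRing.isLinear.Build _ _ _ _ F F_lin).
have [a /eigenvalueP[u u_eig u0]] := eigenvalue_closed (lin1_mx Fl) V_gt0.
exists a, (r2v u); split.
  by apply: contra_neq u0 => u0; rewrite -[u]r2vK u0 linear0.
by apply: (can_inj v2rK); rewrite linearZ /= r2vK -u_eig (mul_rV_lin1 Fl).
Qed.

Section AlgebraScaling.
Variables (C : numClosedFieldType) (A : fdAlg C).

Lemma fdZl (k : C) (a b : A) : (k *: a) * b = k *: (a * b).
Proof. by rewrite [RHS]fd_scaleAl. Qed.

Lemma fdZr (k : C) (a b : A) : a * (k *: b) = k *: (a * b).
Proof. by rewrite [RHS]fd_scaleAr. Qed.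

Definition lmulf (r x : A) : A := r * x.
Lemma lmulf_linear r : linear (lmulf r).
Proof. by move=> k x y; rewrite /lmulf mulrDr fdZr. Qed.
HB.instance Definition _ r :=
  GRing.isLinear.Build C A A _ (lmulf r) (lmulf_linear r).

End AlgebraScaling.

Section StarAlgebra.
Variables (C : numClosedFieldType) (A : frobStarAlg C).

Lemma lambdaZ (k : C) (a : A) : lambda (k *: a) = k * lambda a.
Proof. exact: linearZ. Qed.

Lemma star0 : star (0 : A) = 0.
Proof. by have := starZ 0 (0 : A); rewrite conjC0 !scale0r. Qed.

Lemma mul_star_eq0 (a : A) : a * star a = 0 -> a = 0.
Proof.
move=> aa0; apply/eqP/negP => /negP/form_posdef.
by rewrite aa0 linear0 ltxx.
Qed.

Lemma mul_star_self_eq0 (a : A) : star a * a = 0 -> a = 0.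
Proof.
by rewrite -[X in _ * X]starK => /mul_star_eq0 a0; rewrite -[a]starK a0 star0.
Qed.

End StarAlgebra.

Section Spectrum.
Variables (C : numClosedFieldType) (R : frobStarAlg C).
Hypothesis R_comm : forall a b : R, a * b = b * a.

Definition primitive_idem (f : R) :=
  [/\ f != 0, f * f = f & forall r : R, exists k : C, r * f = k *: f].

(** Positivity makes a commutative [R] reduced: with [y = x * star x], the product [y * star y]
    contains the factor [x * x], so [y] vanishes, and then so does [x]. *)
Lemma sqr_eq0 (x : R) : x * x = 0 -> x = 0.
Proof.
move=> xx0; apply/mul_star_eq0/mul_star_eq0.
by rewrite starM starK mulrA -(mulrA x) (R_comm (star x)) !mulrA xx0 !mul0r.
Qed.

(** Induction on the dimension of the ideal [V]. If all of [R] acts on [V] by scalars, a nonzero [x]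
    in [V] has [x * x = k *: x] with [k] nonzero because [R] is reduced, and [x / k] is the
    idempotent. Otherwise some [r] is not scalar on [V], and an eigenspace of [r] in [V] is a
    smaller nonzero ideal. *)
Lemma ideal_primitive_idem (V : {vspace R}) :
  (forall r x : R, x \in V -> r * x \in V) -> V != 0%VS ->
  exists2 f, f \in V & primitive_idem f.
Proof.
have [n leVn] := ubnP (\dim V); elim: n V leVn => // n IHn V ltVn idV V0.
have [x xV x0] : exists2 x : R, x \in V & x != 0.
  by exists (vpick V); rewrite ?memv_pick ?vpick0.
have [scal|] := pselect (forall r : R, exists k : C,
    forall y : R, y \in V -> r * y = k *: y).
  have [k kx] := scal x.
  have k0 : k != 0.
    apply: contraNneq x0 => k0; apply/eqP/sqr_eq0.
    by rewrite kx // k0 scale0r.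
  exists (k^-1 *: x); first exact: memvZ.
  split=> [||r]; first by rewrite scaler_eq0 negb_or invr_eq0 k0.
    by rewrite fdZl fdZr (kx _ xV) (scalerA _ k) mulVf // scale1r.
  have [l lV] := scal r; exists l; exact/lV/memvZ.
move/existsNP=> [r nscal].
pose F (y : subvs_of V) : subvs_of V := vsproj V (r * vsval y).
have FE y : vsval (F y) = r * vsval y.
  by rewrite /F vsprojK // idV // subvsP.
have F_lin : linear F.
  by move=> a u v; apply: val_inj; rewrite /= !FE !linearP /= mulrDr fdZr -!FE.
pose Fl : {linear _ -> _} := HB.pack F (GRing.isLinear.Build _ _ _ _ F F_lin).
have dimV : (0 < dim (subvs_of V))%N.
  by rewrite -[X in (0 < X)%N]/(\dim V) lt0n dimv_eq0.
have [a [v [v0 /(congr1 vsval)]]] := eigenvector_exists Fl dimV.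
rewrite FE linearZ /= => rv.
pose W := (V :&: lker (linfun (lmulf (r - a *: (1 : R)))))%VS.
have memW y : (y \in W) = (y \in V) && (r * y == a *: y).
  rewrite memv_cap memv_ker lfunE /= /lmulf mulrBl fdZl mul1r.
  by rewrite subr_eq0.
have sWV : (W <= V)%VS by exact: capvSl.
have ltWV : (\dim W < \dim V)%N.
  rewrite ltn_neqAle dimvS // andbT; apply: contra_notN nscal => /eqP dimW.
  have eWV : W = V by apply/eqP; rewrite eqEdim sWV dimW leqnn.
  by exists a => y; rewrite -eWV memW => /andP[_ /eqP].
have [|||f fW pf] := IHn W.
- exact: leq_trans ltWV _.
- move=> s y; rewrite !memW => /andP[yV /eqP ry]; rewrite idV //=.
  by rewrite mulrA (R_comm r) -mulrA ry fdZr.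
- apply: contraNneq v0 => W0; apply/eqP/val_inj; apply/eqP.
  by rewrite -memv0 -W0 memW subvsP rv /=.
by exists f => //; apply: (subvP sWV).
Qed.

(** Induction on the dimension of the ideal [p R]: a primitive idempotent [f] in it is split off,
    and [p - f] is an idempotent orthogonal to [f] that generates a smaller ideal. *)
Lemma idem_decomposition (p : R) : p * p = p ->
  exists s : seq R, [/\ forall f, f \in s -> primitive_idem f,
    uniq s, {in s &, forall f g, f != g -> f * g = 0} & \sum_(f <- s) f = p].
Proof.
(* For an idempotent [q], the kernel of multiplication by [1 - q] is the ideal [q R]. *)
pose V (q : R) := lker (linfun (lmulf (1 - q))).
have memV q y : (y \in V q) = (q * y == y).
  by rewrite memv_ker lfunE /= /lmulf mulrBl mul1r subr_eq0 eq_sym.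
have [n leVn] := ubnP (\dim (V p)); elim: n p leVn => // n IHn p ltVn pp.
have [->|p0] := eqVneq p 0; first by exists [::]; rewrite big_nil.
have pV : p \in V p by rewrite memV pp.
have [||f] := @ideal_primitive_idem (V p).
- by move=> r x; rewrite !memV => /eqP px; rewrite mulrA (R_comm p) -mulrA px.
- by apply: contraNneq p0 => V0; rewrite -memv0 -V0.
rewrite memV => /eqP pf prim_f; have [f0 ff _] := prim_f.
have fp : f * p = f by rewrite R_comm.
pose q := p - f.
have qq : q * q = q by rewrite mulrBl !mulrBr pp pf fp ff subrr subr0.
have qf : q * f = 0 by rewrite mulrBl pf ff subrr.
have ltqp : (\dim (V q) < \dim (V p))%N.
  have sqp : (V q <= V p)%VS.
    apply/subvP => y; rewrite !memV => /eqP <-.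
    by rewrite mulrA mulrBr pp pf.
  rewrite ltn_neqAle dimvS // andbT; apply: contra_neqN f0 => /eqP dimq.
  have eVV : V q = V p by apply/eqP; rewrite eqEdim sqp dimq leqnn.
  have : f \in V q by rewrite eVV memV pf.
  by rewrite memV qf => /eqP.
have [|s [prim_s uniq_s orth_s sum_s]] := IHn q _ qq.
  exact: leq_trans ltqp _.
have sq g : g \in s -> g * q = g.
  move=> gs; rewrite -sum_s mulr_sumr (bigD1_seq g) //= big_seq_cond big1.
    by rewrite addr0; have [] := prim_s g gs.
  by move=> h /andP[hs hg]; apply: orth_s; rewrite // eq_sym.
have sf g : g \in s -> g * f = 0.
  by move=> gs; rewrite -(sq g gs) -mulrA qf mulr0.
exists (f :: s); split.
- by move=> g; rewrite inE => /orP[/eqP->|/prim_s].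
- rewrite /= uniq_s andbT; apply: contraNN f0 => /sf; rewrite ff.
  by move/eqP.
- move=> g h; rewrite !inE => /orP[/eqP->|gs] /orP[/eqP->|hs].
  + by rewrite eqxx.
  + by rewrite R_comm sf.
  + by rewrite sf.
  + exact: orth_s.
- by rewrite big_cons sum_s addrC subrK.
Qed.

End Spectrum.

(** * Coordinates on the base algebra *)

Section FrobHom.
Variables (C : numClosedFieldType) (A B : frobStarAlg C) (f : A -> B).
Hypothesis f_hom : frob_hom f.

Lemma fhomM a b : f (a * b) = f a * f b.
Proof. by case: f_hom => _ [_ ->]. Qed.

Lemma fhom1 : f 1 = 1.
Proof. by case: f_hom => _ [-> _]. Qed.

Lemma fhomD a b : f (a + b) = f a + f b.
Proof. by case: f_hom => lin _ _ _; rewrite -[a]scale1r lin !scale1r. Qed.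

Lemma fhom0 : f 0 = 0.
Proof. by apply: (@addrI _ (f 0)); rewrite -fhomD !addr0. Qed.

Lemma fhomZ k a : f (k *: a) = k *: f a.
Proof. by case: f_hom => lin _ _ _; rewrite -[k *: a]addr0 lin fhom0 addr0. Qed.

Lemma fhom_lambda a : lambda (f a) = lambda a.
Proof. by case: f_hom. Qed.

Lemma fhom_star a : f (star a) = star (f a).
Proof. by case: f_hom. Qed.

Lemma fhom_sum (I : finType) (P : pred I) (F : I -> A) :
  f (\sum_(i | P i) F i) = \sum_(i | P i) f (F i).
Proof. exact: (big_morph _ fhomD fhom0). Qed.

End FrobHom.

(** Identifies [R] with the functions on [npt] points: the [idem i] are the indicator functions and
    [coor i] is evaluation at [i]. That [coor i] is a character need not be recorded, as it follows
    from [coorE] and [idem_neq0]. *)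
Record spectrum (G : finGroupType) (C : numClosedFieldType)
    (R : frobStarAlg C) (rho : frobAction G R) := Spectrum {
  npt : nat;
  idem : 'I_npt -> R;
  coor : 'I_npt -> R -> C;
  ptact : G -> 'I_npt -> 'I_npt;
  spec_comm : forall a b : R, a * b = b * a;
  idem_neq0 : forall i, idem i != 0;
  idemM : forall i j, idem i * idem j = if i == j then idem i else 0;
  sum_idem : \sum_i idem i = 1;
  coorE : forall i r, r * idem i = coor i r *: idem i;
  ptactE : forall g i, rho g (idem i) = idem (ptact g i)
}.

Arguments idem {G C R rho} s.
Arguments coor {G C R rho} s.
Arguments ptact {G C R rho} s.
Arguments idem_neq0 {G C R rho} s.
Arguments idemM {G C R rho} s.
Arguments sum_idem {G C R rho} s.
Arguments coorE {G C R rho} s.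
Arguments ptactE {G C R rho} s.

Lemma spectrum_exists (G : finGroupType) (C : numClosedFieldType)
    (R : frobStarAlg C) (rho : frobAction G R) :
  (forall a b : R, a * b = b * a) -> inhabited (spectrum rho).
Proof.
move=> R_comm.
have [s [prim_s uniq_s orth_s sum_s]] := idem_decomposition R_comm (mul1r 1).
pose e (i : 'I_(size s)) := s`_i.
have es i : e i \in s by exact: mem_nth.
have e0 i : e i != 0 by have [] := prim_s _ (es i).
have eM i j : e i * e j = if i == j then e i else 0.
  have [->|ij] := eqVneq i j; first by have [] := prim_s _ (es j).
  by apply: orth_s => //; rewrite nth_uniq.
have sum_e : \sum_i e i = 1 by rewrite -sum_s (big_nth 0) big_mkord.
have /choice[cf cfE] : forall p : 'I_(size s) * R, exists k : C,
  p.2 * e p.1 = k *: e p.1 by move=> [i r]; have [] := prim_s _ (es i).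
(* The [e j] sum to 1, so [f * e j] is nonzero for some [j]. It is a multiple of [f] and of [e j],
   and idempotency turns both multiples into equalities. Hence the [e j] are all the primitive
   idempotents, and automorphisms permute them. *)
have prim_e f : primitive_idem f -> exists j, f = e j.
  case=> f0 ff fr.
  have [j fj0] : exists j, f * e j != 0.
    apply/existsP; apply: contraNT f0 => /existsPn fe0.
    rewrite -[f]mulr1 -sum_e mulr_sumr big1 // => j _.
    by apply/eqP; have := fe0 j; rewrite negbK.
  have [k kf] := fr (e j); exists j.
  have fk : f * e j = k *: f by rewrite R_comm.
  have fl := cfE (j, f); rewrite /= in fl.
  have idk : k *: f = f.
    have k0 : k != 0 by apply: contraNneq fj0 => k0; rewrite fk k0 scale0r.
    by apply: (scalerI k0); rewrite -fk -fdZl -fk -mulrA eM eqxx.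
  have idl : cf (j, f) *: e j = e j.
    have l0 : cf (j, f) != 0.
      by apply: contraNneq fj0 => l0; rewrite fl l0 scale0r.
    by apply: (scalerI l0); rewrite -fl -fdZr -fl mulrA ff.
  by rewrite -idk -idl -fk.
have /choice[a aE] : forall p : G * 'I_(size s), exists j,
    rho p.1 (e p.2) = e j.
  move=> [g i] /=; have [ei0 eiei eir] := prim_s _ (es i).
  have hg := gact_hom rho g.
  have rhoK r : rho g (rho g^-1%g r) = r.
    by rewrite -Defs.gactM mulgV Defs.gact1.
  apply: prim_e; split.
  - apply: contraNneq ei0 => ge0; rewrite -[e i](Defs.gact1 rho) -(mulVg g).
    by rewrite Defs.gactM ge0 (fhom0 (gact_hom rho _)).
  - by rewrite -(fhomM hg) eiei.
  - move=> r; have [k kE] := eir (rho g^-1%g r).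
    by exists k; rewrite -{1}[r]rhoK -(fhomM hg) kE (fhomZ hg).
constructor.
exists (size s) e (fun i r => cf (i, r)) (fun g i => a (g, i)) => //.
- by move=> i r; exact: (cfE (i, r)).
- by move=> g i; exact: (aE (g, i)).
Qed.

Section SpectrumTheory.
Variables (G : finGroupType) (C : numClosedFieldType) (R : frobStarAlg C).
Variables (rho : frobAction G R) (S : spectrum rho).
Notation e := (idem S).
Notation x_ := (coor S).
Notation "g • i" := (ptact S g i) (at level 38, right associativity).

Lemma idemZI i : injective (fun k : C => k *: e i).
Proof.
move=> k l /= /eqP; rewrite -subr_eq0 -scalerBl scaler_eq0 subr_eq0.
by rewrite (negPf (idem_neq0 S i)) orbF => /eqP.
Qed.

Lemma idem_inj : injective e.
Proof.
move=> i j eij; have := idemM S i j; case: eqVneq => // _.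
by rewrite -eij idemM eqxx => ei0; have := idem_neq0 S i; rewrite ei0 eqxx.
Qed.

Lemma coorD i r s : x_ i (r + s) = x_ i r + x_ i s.
Proof. by apply: (@idemZI i); rewrite /= scalerDl -!coorE mulrDl. Qed.

Lemma coorZ i k r : x_ i (k *: r) = k * x_ i r.
Proof. by apply: (@idemZI i); rewrite /= -scalerA -!coorE fdZl. Qed.

Lemma coor0 i : x_ i 0 = 0.
Proof. by apply: (@idemZI i); rewrite /= -coorE mul0r scale0r. Qed.

Lemma coor1 i : x_ i 1 = 1.
Proof. by apply: (@idemZI i); rewrite /= -coorE mul1r scale1r. Qed.

Lemma coorM i r s : x_ i (r * s) = x_ i r * x_ i s.
Proof.
apply: (@idemZI i); rewrite /= -coorE -mulrA coorE fdZr coorE scalerA.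
by rewrite mulrC.
Qed.

Lemma coor_idem i j : x_ i (e j) = (i == j)%:R.
Proof.
apply: (@idemZI i); rewrite /= -coorE idemM eq_sym.
by case: eqVneq => [->|_]; rewrite ?scale1r ?scale0r.
Qed.

Lemma coor_sum (I : finType) (P : pred I) (F : I -> R) i :
  x_ i (\sum_(j | P j) F j) = \sum_(j | P j) x_ i (F j).
Proof. exact: (big_morph _ (coorD i) (coor0 i)). Qed.

Definition of_coor (F : 'I_(npt S) -> C) : R := \sum_i F i *: e i.

Lemma coorK r : of_coor (x_ ^~ r) = r.
Proof.
rewrite -[RHS]mulr1 -(sum_idem S) mulr_sumr.
by apply: eq_bigr => i _; rewrite coorE.
Qed.

Lemma of_coorK F i : x_ i (of_coor F) = F i.
Proof.
rewrite coor_sum (bigD1 i) //= big1 => [|j ji].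
  by rewrite coorZ coor_idem eqxx mulr1 addr0.
by rewrite coorZ coor_idem eq_sym (negPf ji) mulr0.
Qed.

Lemma coor_inj r s : (forall i, x_ i r = x_ i s) -> r = s.
Proof.
by move=> rs; rewrite -(coorK r) -(coorK s); apply: eq_bigr => i _; rewrite rs.
Qed.

(** The element [star (e i) * e i] is self-adjoint and equals [k *: e i] with [k] nonzero by
    positivity. Comparing it with its star shows [star (e i)] to be a multiple of [e i], and an
    idempotent nonzero multiple of [e i] is [e i]. *)
Lemma star_idem i : star (e i) = e i.
Proof.
have ee := coorE S i (star (e i)); set k := x_ i _ in ee.
have k0 : k != 0.
  apply: contraNneq (idem_neq0 S i) => k0; apply/eqP.
  by apply: mul_star_self_eq0; rewrite ee k0 scale0r.
have kc0 : k^* != 0 by rewrite conjC_eq0.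
have eke : star (e i) = (k / k^*) *: e i.
  apply: (scalerI kc0); rewrite scalerA mulrCA divff // mulr1 -ee.
  by rewrite -starZ -ee starM starK.
have kk0 : k / k^* != 0 by rewrite mulf_neq0 ?invr_eq0.
have := congr1 (@star C R) (idemM S i i); rewrite eqxx starM eke.
by rewrite fdZl fdZr idemM eqxx => /(scalerI kk0).
Qed.

Lemma coor_star i r : x_ i (star r) = (x_ i r)^*.
Proof.
apply: (@idemZI i); rewrite /= -coorE -{1}(star_idem i) -starM.
by rewrite (spec_comm S) coorE starZ star_idem.
Qed.

Lemma lambda_idem_gt0 i : 0 < lambda (e i).
Proof.
by have := form_posdef (idem_neq0 S i); rewrite star_idem idemM eqxx.
Qed.

Lemma lambda_coor r : lambda r = \sum_i x_ i r * lambda (e i).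
Proof.
by rewrite -{1}[r]coorK linear_sum; apply: eq_bigr => i _; rewrite lambdaZ.
Qed.

Lemma ptact1 i : 1%g • i = i.
Proof. by apply: idem_inj; rewrite -ptactE Defs.gact1. Qed.

Lemma ptactM g h i : (g * h)%g • i = g • h • i.
Proof. by apply: idem_inj; rewrite -!ptactE Defs.gactM. Qed.

Lemma ptactK g i : g^-1%g • g • i = i.
Proof. by rewrite -ptactM mulVg ptact1. Qed.

Lemma ptactVK g i : g • g^-1%g • i = i.
Proof. by rewrite -ptactM mulgV ptact1. Qed.

Lemma ptactVfix g i : g • i = i -> g^-1%g • i = i.
Proof. by move=> gi; rewrite -{1}gi ptactK. Qed.

Lemma ptactMfix g h i : g • i = i -> h • i = i -> (g * h)%g • i = i.
Proof. by move=> gi hi; rewrite ptactM hi gi. Qed.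

Lemma ptactJfix g h i : g • i = i -> (h * g * h^-1)%g • h • i = h • i.
Proof. by move=> gi; rewrite !ptactM ptactK gi. Qed.

Lemma coor_act g i r : x_ i (rho g r) = x_ (g^-1%g • i) r.
Proof.
have eE : e i = rho g (e (g^-1%g • i)) by rewrite ptactE ptactVK.
apply: (@idemZI i); rewrite /= -coorE eE.
by rewrite -(fhomM (gact_hom rho g)) coorE (fhomZ (gact_hom rho g)).
Qed.

Lemma lambda_idem_act g i : lambda (e (g • i)) = lambda (e i).
Proof. by rewrite -ptactE (fhom_lambda (gact_hom rho g)). Qed.

Lemma is_unit_coor r : is_unit r <-> forall i, x_ i r != 0.
Proof.
split=> [[s [rs _]] i|r0].
  apply/negP => /eqP ri0; have := coor1 i.
  by rewrite -rs coorM ri0 mul0r => /eqP; rewrite eq_sym oner_eq0.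
exists (of_coor (fun i => (x_ i r)^-1)); rewrite [_ * r](spec_comm S).
suff: r * of_coor (fun i => (x_ i r)^-1) = 1 by [].
by apply: coor_inj => i; rewrite coorM of_coorK coor1 divff.
Qed.

Lemma cocycle_neq0 c g h i : cocycle2 rho c -> x_ i (c g h) != 0.
Proof. by case=> cu _; move/is_unit_coor: (cu g h). Qed.

Lemma cocycle_coor c g h k i : cocycle2 rho c ->
  x_ (g^-1%g • i) (c h k) * x_ i (c g (h * k)%g) =
  x_ i (c (g * h)%g k) * x_ i (c g h).
Proof. by case=> _ /(_ g h k)/(congr1 (x_ i)); rewrite !coorM coor_act. Qed.

End SpectrumTheory.

(** * Fibres of an extension *)

Section Fibers.
Variables (G : finGroupType) (C : numClosedFieldType) (R : frobStarAlg C).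
Variables (rho : frobAction G R) (S : spectrum rho) (E : crossedExt rho).
Notation e := (idem S).
Notation x_ := (coor S).
Notation "g • i" := (ptact S g i) (at level 38, right associativity).
Notation j := (ext_emb E).
Notation eps i := (j (e i)).
Let j_hom : frob_hom j := ext_emb_hom E.
Let g_hom g : frob_hom (cact E g) := gact_hom (cact E) g.

Lemma emb_comp1 r : j r \in hcomp E 1%g.
Proof. by apply/ext_emb_im; exists r. Qed.

(** This is the crossing relation for an element of degree 1, since the identity of [G] acts
    trivially. *)
Lemma emb_central r a : a * j r = j r * a.
Proof. by rewrite (cact_cross a (emb_comp1 r)) Defs.gact1. Qed.

Lemma emb_epsE r i : j r * eps i = x_ i r *: eps i.
Proof. by rewrite -(fhomM j_hom) coorE (fhomZ j_hom). Qed.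

Lemma eps_neq0 i : eps i != 0.
Proof.
apply: contraNneq (idem_neq0 S i) => ei0; apply/eqP.
by apply: (@ext_emb_inj _ _ _ _ E); rewrite ei0 (fhom0 j_hom).
Qed.

Lemma epsM i k : eps i * eps k = if i == k then eps i else 0.
Proof.
rewrite -(fhomM j_hom) idemM.
by case: eqP => // _; rewrite (fhom0 j_hom).
Qed.

Lemma sum_eps : \sum_i eps i = 1.
Proof. by rewrite -(fhom_sum j_hom) sum_idem (fhom1 j_hom). Qed.

Lemma lambda_eps i : lambda (eps i) = lambda (e i).
Proof. exact: fhom_lambda. Qed.

Lemma comp_starV g a : a \in hcomp E g -> star a \in hcomp E g^-1%g.
Proof. by move=> ag; apply/comp_star; exists a. Qed.

(** The subspace [e_i A_g], kept as a predicate given by equations; the side on which [eps i]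
    multiplies is immaterial because [R] is central. *)
Definition fiber g i : {pred E} :=
  fun a => (a \in hcomp E g) && (a * eps i == a).

Lemma fiberP g i a :
  reflect (a \in hcomp E g /\ a * eps i = a) (a \in fiber g i).
Proof. by apply: (iffP andP) => [[-> /eqP]|[-> /eqP]]. Qed.

Lemma mem_fiber g i a : a \in hcomp E g -> a * eps i \in fiber g i.
Proof.
move=> ag; apply/fiberP; split; last by rewrite -mulrA epsM eqxx.
by have := comp_mul ag (emb_comp1 (e i)); rewrite mulg1.
Qed.

Lemma fiber0 g i : 0 \in fiber g i.
Proof. by apply/fiberP; rewrite mem0v mul0r. Qed.

Lemma fiberZ g i k a : a \in fiber g i -> k *: a \in fiber g i.
Proof. by move=> /fiberP[ag ai]; apply/fiberP; rewrite memvZ // fdZl ai. Qed.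

Lemma fiber1 i a : a \in fiber 1%g i -> exists k, a = k *: eps i.
Proof.
by case/fiberP => /ext_emb_im[r ->] <-; exists (x_ i r); rewrite emb_epsE.
Qed.

Lemma fiberM g h i a b :
  a \in fiber g i -> b \in fiber h i -> a * b \in fiber (g * h)%g i.
Proof.
move=> /fiberP[ag ai] /fiberP[bh bi]; apply/fiberP.
by rewrite comp_mul // -mulrA bi.
Qed.

Lemma fiber_star g i a : a \in fiber g i -> star a \in fiber g^-1%g i.
Proof.
move=> /fiberP[ag ai]; apply/fiberP; rewrite comp_starV //; split=> //.
by rewrite emb_central -{2}ai starM -(fhom_star j_hom) star_idem.
Qed.

Lemma fiber_act g h i a :
  a \in fiber g i -> cact E h a \in fiber (h * g * h^-1)%g (h • i).
Proof.
move=> /fiberP[ag ai]; apply/fiberP; rewrite cact_comp //; split=> //.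
by rewrite -ptactE -ext_emb_act -(fhomM (g_hom h)) ai.
Qed.

(** The product lies in the degree 1 fibre over [i], which is spanned by [eps i], and [lambda] reads
    off the coefficient. *)
Lemma fiber_norm g i a : a \in fiber g i ->
  a * star a = (lambda (a * star a) / lambda (e i)) *: eps i.
Proof.
move=> ag; have := fiberM ag (fiber_star ag); rewrite mulgV => /fiber1[k kE].
by rewrite kE lambdaZ lambda_eps mulfK // gt_eqF // lambda_idem_gt0.
Qed.

Lemma fiber_normC g i a : a \in fiber g i -> star a * a = a * star a.
Proof.
move=> ag; rewrite (fiber_norm ag).
have := fiberM (fiber_star ag) ag; rewrite mulVg => /fiber1[k kE].
rewrite lambda_class {1 2}kE lambdaZ lambda_eps mulfK // gt_eqF //.
exact: lambda_idem_gt0.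
Qed.

Lemma fiber_norm_gt0 g i a : a \in fiber g i -> a != 0 ->
  0 < lambda (a * star a) / lambda (e i).
Proof. by move=> ag a0; rewrite divr_gt0 ?lambda_idem_gt0 // form_posdef. Qed.

(** In [b * star a * a] the first two factors give a multiple of [eps i], hence the whole a multiple
    of [a]; the last two give a nonzero multiple of [eps i], hence the whole a nonzero multiple of
    [b]. *)
Lemma fiber_dim1 g i a b : a \in fiber g i -> a != 0 -> b \in fiber g i ->
  exists k, b = k *: a.
Proof.
move=> ag a0 bg; have := fiberM bg (fiber_star ag).
rewrite mulgV => /fiber1[k kE].
have /fiberP[_ ai] := ag; have /fiberP[_ bi] := bg.
have N0 := lt0r_neq0 (fiber_norm_gt0 ag a0); set N := _ / _ in N0.
have : b * (star a * a) = k *: a by rewrite mulrA kE fdZl -emb_central ai.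
rewrite (fiber_normC ag) (fiber_norm ag) fdZr bi => Nb; exists (N^-1 * k).
by rewrite -scalerA -Nb scalerA mulVf // scale1r.
Qed.

(** Crossing [eps i] past [a] turns it into [eps (g • i)], so [a = a * eps i * eps (g • i)], which
    is 0 if the two points differ. *)
Lemma fiber_fix g i a : a \in fiber g i -> a != 0 -> g • i = i.
Proof.
move=> /fiberP[ag ai]; apply: contra_neq_eq => gi; rewrite -ai.
rewrite (cact_cross _ ag) ext_emb_act ptactE -emb_central -ai -mulrA.
by rewrite epsM eq_sym (negPf gi) mulr0.
Qed.

Lemma fiberM_neq0 g h i a b : a \in fiber g i -> b \in fiber h i ->
  a != 0 -> b != 0 -> a * b != 0.
Proof.
move=> /fiberP[ag ai] bh a0 b0; apply: contra_neq a0 => ab0.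
have N0 := lt0r_neq0 (fiber_norm_gt0 bh b0).
have : a * (b * star b) = 0 by rewrite mulrA ab0 mul0r.
rewrite (fiber_norm bh) fdZr ai => /eqP.
by rewrite scaler_eq0 (negPf N0) => /eqP.
Qed.

Lemma fiber_mulIr g h k i a b u :
  a \in fiber g i -> b \in fiber h i -> u \in fiber k i -> u != 0 ->
  a * u = b * u -> a = b.
Proof.
move=> /fiberP[_ ai] /fiberP[_ bi] uk u0 /(congr1 ( *%R^~ (star u))) /=.
rewrite -!mulrA (fiber_norm uk) !fdZr ai bi.
exact: (scalerI (lt0r_neq0 (fiber_norm_gt0 uk u0))).
Qed.

Lemma fiberM_eq0 g h i k a b : i != k ->
  a \in fiber g i -> b \in fiber h k -> a * b = 0.
Proof.
move=> ik /fiberP[_ <-] /fiberP[_ <-].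
by rewrite (emb_central (e k)) -mulrA (mulrA (eps i)) epsM (negPf ik) mul0r
  mulr0.
Qed.

(** For distinct degrees the product has a degree other than 1, where [lambda] vanishes; for equal
    degrees and distinct points the product itself is 0. *)
Lemma lambda_orthogonal g h i k a b : (g, i) != (h, k) ->
  a \in fiber g i -> b \in fiber h k -> lambda (a * star b) = 0.
Proof.
move=> ghik ag /fiber_star bh; have [gh|gh] := eqVneq g h.
  have ik : i != k by apply: contraNneq ghik => ->; rewrite gh.
  by rewrite (fiberM_eq0 ik ag bh) linear0.
apply: (@comp_lambda _ _ E (g * h^-1)%g); first by rewrite eq_mulgV1 in gh.
by have /fiberP[? _] := ag; have /fiberP[? _] := bh; exact: comp_mul.
Qed.

Lemma act_neq0 h (a : E) : a != 0 -> cact E h a != 0.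
Proof.
apply: contra_neq => ha0; rewrite -[a](Defs.gact1 (cact E)) -(mulVg h).
by rewrite Defs.gactM ha0 (fhom0 (g_hom _)).
Qed.

Lemma sum_fibers a : exists k : G -> 'I_(npt S) -> E,
  (forall g i, k g i \in fiber g i) /\ a = \sum_g \sum_i k g i.
Proof.
have : a \in (\sum_(g : G) hcomp E g)%VS by rewrite comp_full memvf.
case/memv_sumP => b bg ->; exists (fun g i => b g * eps i); split.
  by move=> g i; apply/mem_fiber/bg.
by apply: eq_bigr => g _; rewrite -mulr_sumr sum_eps mulr1.
Qed.

End Fibers.
Arguments fiber {G C R rho S} E g i.

(** * Strictness in terms of the fibres *)

Section Strictness.
Variables (G : finGroupType) (C : numClosedFieldType) (R : frobStarAlg C).
Variables (rho : frobAction G R) (S : spectrum rho) (E : crossedExt rho).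
Notation e := (idem S).
Notation x_ := (coor S).
Notation "g • i" := (ptact S g i) (at level 38, right associativity).
Notation j := (ext_emb E).
Notation eps i := (j (e i)).
Let j_hom : frob_hom j := ext_emb_hom E.

Definition emb1 r : comp1 E := Subvs (emb_comp1 E r).

Lemma emb1_surj (y : comp1 E) : exists r, y = emb1 r.
Proof.
by have /ext_emb_im[r yr] := subvsP y; exists r; apply: val_inj.
Qed.

Definition sim_at (x : sim (comp1 E)) i := forall r, x (emb1 r) = x_ i r.

(** A character cannot kill every [e i], because these sum to 1. If it does not kill [e i], applying
    it to [r * e i = x_ i r *: e i] identifies it with [x_ i]. *)
Lemma sim_at_exists (x : sim (comp1 E)) : exists i, sim_at x i.
Proof.
have x0 : x 0 = 0.
  have := chi_linear x 1 0 0; rewrite scale1r addr0 mul1r.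
  by rewrite -{1}[x 0]addr0 => /addrI.
have xZ k y : x (k *: y) = k * x y.
  by have := chi_linear x k y 0; rewrite x0 !addr0.
have xD y z : x (y + z) = x y + x z.
  by have := chi_linear x 1 y z; rewrite scale1r mul1r.
have [x1 xM] := chi_monoid x.
have [i xi0] : exists i, x (emb1 (e i)) != 0.
  apply/existsP; apply: contraT => /existsPn xe0.
  have : x 1 != 0 by rewrite x1 oner_eq0.
  have -> : 1 = \sum_i emb1 (e i).
    by apply: val_inj; rewrite /= raddf_sum /= sum_eps.
  rewrite (big_morph _ xD x0) big1 ?eqxx // => i _.
  by apply/eqP; have := xe0 i; rewrite negbK.
exists i => r; apply: (mulIf xi0); rewrite -xM -xZ; congr (x _).
by apply: val_inj; rewrite /= emb_epsE.
Qed.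

Lemma sim_exists i : exists x : sim (comp1 E), sim_at x i.
Proof.
(* [q] is the inverse of the embedding of [R] onto the trivial component. *)
have /choice[q qE] := emb1_surj.
have jq y : j (q y) = vsval y by rewrite [in RHS](qE y).
have qj r : q (emb1 r) = r by apply: (@ext_emb_inj _ _ _ _ E); rewrite jq.
have lin : scalar (fun y => x_ i (q y)).
  move=> k y z; rewrite -coorZ -coorD; congr (x_ i _).
  by apply: (@ext_emb_inj _ _ _ _ E); rewrite (fhomD j_hom) (fhomZ j_hom) !jq.
have mon : monoid_morphism (fun y => x_ i (q y)).
  split=> [|y z].
    have -> : q 1 = 1.
      by apply: (@ext_emb_inj _ _ _ _ E); rewrite jq (fhom1 j_hom).
    exact: coor1.
  rewrite -coorM; congr (x_ i _).
  by apply: (@ext_emb_inj _ _ _ _ E); rewrite (fhomM j_hom) !jq.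
by exists (Sim lin mon) => r /=; rewrite qj.
Qed.

Section AtPoint.
Variables (g : G) (x : sim (comp1 E)) (i : 'I_(npt S)).
Hypothesis xi : sim_at x i.

Lemma sim_atE (y : comp1 E) : vsval y * eps i = x y *: eps i.
Proof. by have [r ->] := emb1_surj y; rewrite xi emb_epsE. Qed.

Lemma sim_at_idem : x (emb1 (e i)) = 1.
Proof. by rewrite xi coor_idem eqxx. Qed.

Lemma action_fixed_fix : action_fixed g x <-> g • i = i.
Proof.
have actE r : x (cact1 g^-1%g (emb1 r)) = x_ (g • i) r.
  have -> : cact1 g^-1%g (emb1 r) = emb1 (rho g^-1%g r).
    by apply: val_inj; rewrite /= ext_emb_act.
  by rewrite xi coor_act invgK.
split=> [fx|gi r].
  have := fx (emb1 (e i)); rewrite actE sim_at_idem coor_idem.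
  by case: eqVneq => // _ /eqP; rewrite eq_sym oner_eq0.
by have [s ->] := emb1_surj r; rewrite actE gi xi.
Qed.

(** The tensor product of [A_g] with the simple module at [i] is the fibre [e_i A_g]. It is 0 if the
    fibre is; otherwise a generator [a] identifies it with the base field, on which the trivial
    component acts through [x]. *)
Lemma partial_fixed_fiber :
  partial_fixed g x <-> exists2 a, a \in fiber E g i & a != 0.
Proof.
split=> [[T [t [[tDl tDr tB] t_univ] _] [f [f' _ f'K]]]|[a ai a0]].
  apply: contrapT => nofiber.
  (* A tensor of [y] and [z] is unchanged when [e i] is applied to [z], and moving [e i] to the left
     factor gives [y * eps i], which lies in a fibre assumed to be 0. *)
  have t0 y z : t y z = 0.
    have -> : z = emb1 (e i) *: z.
      by rewrite /GRing.scale /= /sim_scale sim_at_idem mul1r.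
    rewrite -tB; have -> : comp_ract y (emb1 (e i)) = 0.
      apply: val_inj; apply/eqP; apply: contra_notT nofiber => y0.
      by exists (vsval y * eps i); first exact/mem_fiber/subvsP.
    by apply: (@addrI _ (t 0 z)); rewrite -tDl !addr0.
  (* All pure tensors vanish, so uniqueness in the universal property equates the identity of [T]
     with the zero map, although [T] is isomorphic to the base field. *)
  have [|h hE h_uniq] := t_univ T (fun _ _ => 0).
    by split=> *; rewrite ?addr0.
  have T0 (u : T) : u = 0.
    have -> : u = h u by apply: (h_uniq idfun) => y z; rewrite /= t0.
    by rewrite -(h_uniq \0) // => y z.
  have : (1 : C) == 0 :> C.
    by apply/eqP; rewrite -[LHS](f'K 1) (T0 (f' 1)) linear0.
  by rewrite oner_eq0.
have /fiberP[ag aia] := ai.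
have /choice[k kE] : forall y : subvs_of (hcomp E g), exists k : C,
    vsval y * eps i = k *: a.
  by move=> y; apply: (fiber_dim1 ai a0); apply/mem_fiber/subvsP.
have kI k1 k2 : k1 *: a = k2 *: a -> k1 = k2.
  move/eqP; rewrite -subr_eq0 -scalerBl scaler_eq0 (negPf a0) orbF subr_eq0.
  by move/eqP.
have kr y r : k (comp_ract y r) = k y * x r.
  apply: kI; rewrite -kE /= -mulrA sim_atE fdZr kE scalerA.
  by rewrite mulrC.
(* [k y] is the coordinate of [y * eps i] along the generator [a]. *)
pose t (y : subvs_of (hcomp E g)) (z : sim_mod x) : sim_mod x := k y * z : C.
exists (sim_mod x); last by exists idfun; exists idfun.
exists t; last first.
  move=> r y z; rewrite /GRing.scale /= /sim_scale /t mulrA; congr (_ * z).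
  have <- : comp_ract y r = comp_lact r y.
    apply: val_inj; rewrite /=; have [s ->] := emb1_surj r.
    by rewrite /= emb_central.
  by rewrite kr mulrC.
split.
  split=> [y y' z|y z z'|y r z]; rewrite /t.
  - rewrite -[RHS](@mulrDl C); congr (_ * z); apply: kI.
    by rewrite -kE /= mulrDl !kE scalerDl.
  - exact: (@mulrDr C).
  - by rewrite kr /GRing.scale /= /sim_scale mulrA.
move=> Z u [uDl uDr uB].
(* A factorisation through [t] is determined on the tensors with left factor [a], because
   [k a1 = 1]. *)
pose a1 : subvs_of (hcomp E g) := Subvs ag.
have ua1D : {morph u a1 : z z' / z + z'} by move=> z z'; exact: uDr.
have ua10 : u a1 0 = 0 by apply: (@addrI _ (u a1 0)); rewrite -uDr !addr0.
pose F : {additive sim_mod x -> Z} :=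
  HB.pack (u a1) (GRing.isNmodMorphism.Build _ _ (u a1) (ua10, ua1D)).
have k1 : k a1 = 1 by apply: kI; rewrite -kE /= aia scale1r.
exists F => [y z|F' F'E z].
  pose r : comp1 E := emb1 (k y *: e i).
  have -> : t y z = r *: z.
    by rewrite /GRing.scale /= /sim_scale xi coorZ coor_idem eqxx mulr1.
  rewrite /= -uB; have zE : z = emb1 (e i) *: z.
    by rewrite /GRing.scale /= /sim_scale sim_at_idem mul1r.
  rewrite zE -!uB; congr (u _ z); apply: val_inj => /=.
  by rewrite kE -mulrA emb_epsE coorZ coor_idem eqxx mulr1 fdZr aia.
by rewrite /= -F'E /t k1 mul1r.
Qed.

End AtPoint.

(** Only one implication is a condition on [E]: a nonzero fibre of degree [g] over [i] always forces
    [g] to fix [i]. *)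
Lemma strict_fibers : strict E <->
  forall g i, g • i = i -> exists2 a, a \in fiber E g i & a != 0.
Proof.
split=> [strE g i gi|fibE g x].
  have [x xi] := sim_exists i; apply/(partial_fixed_fiber g xi)/strE.
  exact/(action_fixed_fix g xi).
have [i xi] := sim_at_exists x.
rewrite (partial_fixed_fiber g xi) (action_fixed_fix g xi).
by split=> [[a ai a0]|/fibE]; first exact: fiber_fix ai a0.
Qed.

End Strictness.

(** * Cocycles and stabilisers *)

Section OrbitTransversal.
Variables (G : finGroupType) (C : numClosedFieldType) (R : frobStarAlg C).
Variables (rho : frobAction G R) (S : spectrum rho).
Notation "g • i" := (ptact S g i) (at level 38, right associativity).

Definition orbit_root i := odflt i [pick k | [exists g, g • k == i]].

Lemma orbit_rootP i : exists g, g • orbit_root i = i.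
Proof.
rewrite /orbit_root; case: pickP => [k /existsP[g /eqP gk]|/(_ i)/existsP[]].
  by exists g.
by exists 1%g; rewrite ptact1.
Qed.

Lemma orbit_root_act h i : orbit_root (h • i) = orbit_root i.
Proof.
rewrite /orbit_root (@eq_pick _ _ [pred k | [exists g, g • k == i]]) => [|k /=].
  by case: pickP => [//|/(_ i)/existsP[]]; exists 1%g; rewrite ptact1.
apply/existsP/existsP => -[g /eqP gk].
  by exists (h^-1 * g)%g; rewrite ptactM gk ptactK.
by exists (h * g)%g; rewrite ptactM gk.
Qed.

Definition transl i : G := sval (cid (orbit_rootP i)).

Lemma translE i : transl i • orbit_root i = i.
Proof. exact: svalP (cid (orbit_rootP i)). Qed.

(* The retraction of the action groupoid onto the stabilisers of the roots;
   here [g] is viewed as an arrow from [g^-1 • i] to [i]. *)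
Definition retract g i : G :=
  ((transl i)^-1 * g * transl (g^-1%g • i))%g.

Lemma retract_fix g i : retract g i • orbit_root i = orbit_root i.
Proof.
have -> : orbit_root i = orbit_root (g^-1%g • i) by rewrite orbit_root_act.
rewrite /retract !ptactM translE ptactVK orbit_root_act -{2}(translE i).
by rewrite ptactK.
Qed.

Lemma retractM g h i :
  retract (g * h)%g i = (retract g i * retract h (g^-1%g • i))%g.
Proof. by rewrite /retract invMg ptactM !mulgA mulgK. Qed.

Lemma retract_stab g i : g • i = i -> retract g i = (g ^ transl i)%g.
Proof. by move=> gi; rewrite /retract ptactVfix // conjgE mulgA. Qed.

(* Shapiro's lemma in degree 2, injectivity: a cocycle that is a coboundary on
   every stabiliser is a coboundary. *)
Lemma stabilizer_coboundary (d : G -> G -> 'I_(npt S) -> C)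
    (th : G -> 'I_(npt S) -> C) :
  (forall g h i, d g h i != 0) ->
  (forall g h k i, d h k (g^-1%g • i) * d g (h * k)%g i =
     d (g * h)%g k i * d g h i) ->
  (forall g i, g • i = i -> th g i != 0) ->
  (forall g h i, g • i = i -> h • i = i ->
     d g h i * th (g * h)%g i = th g i * th h i) ->
  exists u : G -> 'I_(npt S) -> C, (forall g i, u g i != 0) /\
    forall g h i, d g h i * u (g * h)%g i = u g i * u h (g^-1%g • i).
Proof.
move=> d0 dcoc th0 thM; pose r := orbit_root; pose t := transl.
(* With [j = g^-1 • k] and [s = retract g k] one has [t k * s = g * t j]. The quotient of values of
   [d] compares these two factorisations, and [th] is the given trivialisation at the root. *)
exists (fun g k => th (retract g k) (r k) * d g (t (g^-1%g • k)) k /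
                   d (t k) (retract g k) k).
split=> [g i|g h k]; first by rewrite !mulf_neq0 ?invr_eq0 ?th0 ?retract_fix.
rewrite retractM invMg ptactM; set j := g^-1%g • k; set i := h^-1%g • j.
have rj : r j = r k by exact: orbit_root_act.
set s := retract g k; set s' := retract h j.
have sr : s • r k = r k by exact: retract_fix.
have s'r : s' • r k = r k by rewrite -rj; exact: retract_fix.
have thss := thM _ _ _ sr s'r.
have tk : (t k)^-1%g • k = r k by rewrite -{2}(translE k) ptactK.
have ts : (t k * s = g * t j)%g by rewrite /s /retract !mulgA mulgV mul1g.
have ts' : (t j * s' = h * t i)%g by rewrite /s' /retract !mulgA mulgV mul1g.
(* The cocycle identity at [(g, h, t i)], [(t k, s, s')] and [(g, t j, s')]. The terms
   [d g (h * t i) k] and [d (g * t j) s' k] each occur in two of them and are eliminated. *)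
have H1 := dcoc g h (t i) k; rewrite -/j in H1.
have H2 := dcoc (t k) s s' k; rewrite tk ts in H2.
have H3 := dcoc g (t j) s' k; rewrite -/j ts' in H3.
have b0 := d0 g (h * t i)%g k.
have key : d g h k * d (g * h)%g (t i) k * (d (t k) s k * d (t j) s' j) =
  d s s' (r k) * d (t k) (s * s')%g k * (d g (t j) k * d h (t i) j).
  apply: (mulIf b0).
  transitivity (d (g * h)%g (t i) k * d g h k * d (t k) s k *
    (d (t j) s' j * d g (h * t i)%g k)); first by ring.
  rewrite H3 -H1; transitivity (d (g * t j)%g s' k * d (t k) s k *
    d g (t j) k * d h (t i) j * d g (h * t i)%g k); first by ring.
  by rewrite -H2; ring.
have tss0 : th (s * s')%g (r k) != 0 by apply/th0/ptactMfix.
rewrite rj; apply: (mulIf (d0 (t k) (s * s')%g k)).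
apply: (mulIf (d0 (t k) s k)); apply: (mulIf (d0 (t j) s' j)).
transitivity (th (s * s')%g (r k) *
    (d g h k * d (g * h)%g (t i) k * (d (t k) s k * d (t j) s' j))).
  by rewrite -[in RHS]mulrA; field.
rewrite key; transitivity (d s s' (r k) * th (s * s')%g (r k) *
  (d (t k) (s * s')%g k * (d g (t j) k * d h (t i) j))); first by ring.
by rewrite thss; field; rewrite !d0.
Qed.

End OrbitTransversal.

(** * Extensions afforded by a cocycle *)

Section Frames.
Variables (G : finGroupType) (C : numClosedFieldType) (R : frobStarAlg C).
Variables (rho : frobAction G R) (S : spectrum rho).
Notation e := (idem S).
Notation x_ := (coor S).
Notation "g • i" := (ptact S g i) (at level 38, right associativity).

(* The structure constants of [v] are those of the elements [e_i w_g], with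
   [g] fixing [i], of the crossed product of [R] and [G] twisted by [c], on
   which [h] acts as conjugation by [w_h]. *)
Definition frame (E : crossedExt rho) (c : G -> G -> R)
    (v : G -> 'I_(npt S) -> E) : Prop :=
  [/\ forall g i, v g i \in fiber E g i,
      forall g i, g • i = i -> v g i != 0,
      forall g h i, g • i = i -> h • i = i ->
        v g i * v h i = x_ i (c g h) *: v (g * h)%g i &
      forall g h i, g • i = i ->
        x_ (h • i) (c (h * g * h^-1)%g h) *: cact E h (v g i) =
        x_ (h • i) (c h g) *: v (h * g * h^-1)%g (h • i)].

Definition affords (E : crossedExt rho) (c : G -> G -> R) : Prop :=
  exists v, @frame E c v.

(** The condition that [c' / c] is the coboundary of [u], multiplied out to avoid inverses. *)
Definition cohomologous (c c' : G -> G -> R) : Prop :=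
  exists2 u : G -> R, forall g, is_unit (u g) &
    forall g h, c' g h * u (g * h)%g = c g h * (u g * rho g (u h)).

Lemma cohomologous_cocycle c c' :
  cocycle2 rho c -> cohomologous c c' -> cocycle2 rho c'.
Proof.
move=> cC [u uU cc'].
have u0 g i : x_ i (u g) != 0 by move/(is_unit_coor S): (uU g).
have ccE g h i : x_ i (c' g h) = x_ i (c g h) *
    (x_ i (u g) * x_ (g^-1%g • i) (u h)) / x_ i (u (g * h)%g).
  by rewrite -coor_act -!coorM -cc' coorM mulfK.
have c0 g h i : x_ i (c g h) != 0 by exact: cocycle_neq0.
split=> [g h|g h k].
  apply/(is_unit_coor S) => i.
  by rewrite ccE mulf_neq0 ?invr_eq0 ?mulf_neq0 ?c0 ?u0.
apply: (@coor_inj _ _ _ _ S) => i; rewrite !coorM coor_act !ccE.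
have H := cocycle_coor g h k i cC; rewrite invMg ptactM mulgA.
transitivity ((x_ (g^-1%g • i) (c h k) * x_ i (c g (h * k)%g)) *
   (x_ i (u g) * x_ (g^-1%g • i) (u h) *
    x_ (h^-1%g • g^-1%g • i) (u k)) /
   x_ i (u (g * h * k)%g)).
  by field; rewrite !u0.
by rewrite H; field; rewrite !u0.
Qed.

(** Rescaling [v g i] by the coordinate of [u g] at [i] changes the structure constants by the
    coboundary of [u]. *)
Lemma affords_cohomologous E c c' :
  affords E c -> cohomologous c c' -> affords E c'.
Proof.
move=> [v [vf v0 vM vJ]] [u uU cc'].
have u0 g i : x_ i (u g) != 0 by move/(is_unit_coor S): (uU g).
have ccE g h i : x_ i (c' g h) * x_ i (u (g * h)%g) =
    x_ i (c g h) * (x_ i (u g) * x_ (g^-1%g • i) (u h)).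
  by rewrite -!coorM cc' !coorM coor_act.
exists (fun g i => x_ i (u g) *: v g i).
split=> [g i|g i gi|g h i gi hi|g h i gi].
- exact/fiberZ/vf.
- by rewrite scaler_eq0 negb_or u0 v0.
- rewrite fdZl fdZr vM // !scalerA ccE ptactVfix //; congr (_ *: _).
  by ring.
- rewrite (fhomZ (gact_hom (cact E) h)).
  (* The value of [u] at [h * g] is the common denominator when [c'] is expressed by [c] at
     [(h * g * h^-1, h)] and at [(h, g)]. *)
  apply: (scalerI (u0 (h * g)%g (h • i))).
  have := ccE (h * g * h^-1)%g h (h • i); rewrite mulgVK.
  rewrite (ptactVfix (ptactJfix _ gi)) => H1.
  have := ccE h g (h • i); rewrite ptactK => H2.
  set U := x_ _ (u (h * g)%g) in H1 H2 *.
  set uJ := x_ _ (u (h * g * h^-1)%g) in H1 *.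
  pose k := uJ * x_ (h • i) (u h) * x_ i (u g).
  have H3 : U * (x_ (h • i) (c' (h * g * h^-1)%g h) * x_ i (u g)) =
      k * x_ (h • i) (c (h * g * h^-1)%g h).
    by rewrite mulrA [U * _]mulrC H1 /k; ring.
  have H4 : U * (x_ (h • i) (c' h g) * uJ) = k * x_ (h • i) (c h g).
    by rewrite mulrA [U * _]mulrC H2 /k; ring.
  by rewrite !scalerA -!mulrA H3 H4 -!scalerA vJ.
Qed.

(** Fibres are at most lines, so two frames differ by scalars [th]. These exhibit [c' / c] as a
    coboundary on every stabiliser, and [stabilizer_coboundary] extends this to [G]. *)
Lemma affords_unique E c c' : cocycle2 rho c -> cocycle2 rho c' ->
  affords E c -> affords E c' -> cohomologous c c'.
Proof.
move=> cC c'C [v [vf v0 vM _]] [v' [v'f v'0 v'M _]].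
have c0 g h i : x_ i (c g h) != 0 by exact: cocycle_neq0.
have c'0 g h i : x_ i (c' g h) != 0 by exact: cocycle_neq0.
have /choice[th' th'E] : forall p : G * 'I_(npt S), exists k,
    p.1 • p.2 = p.2 -> v' p.1 p.2 = k *: v p.1 p.2.
  move=> [g i] /=; have [gi|/eqP gi] := eqVneq (g • i) i; last by exists 0.
  by have [k kE] := fiber_dim1 (vf g i) (v0 g i gi) (v'f g i); exists k.
pose th g i := th' (g, i).
have thE g i : g • i = i -> v' g i = th g i *: v g i by exact: (th'E (g, i)).
have th0 g i : g • i = i -> th g i != 0.
  move=> gi; apply: contraNneq (v'0 g i gi) => thz.
  by rewrite thE // thz scale0r.
have [||||u [u0 uE]] := @stabilizer_coboundary _ _ _ _ S
    (fun g h i => x_ i (c' g h) / x_ i (c g h)) th.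
- by move=> g h i; rewrite mulf_neq0 ?invr_eq0.
- move=> g h k i; rewrite !mulf_div (cocycle_coor _ _ _ _ cC).
  by rewrite (cocycle_coor _ _ _ _ c'C).
- exact: th0.
- move=> g h i gi hi; have ghi := ptactMfix gi hi.
  have := v'M g h i gi hi; rewrite !thE // fdZl fdZr vM // !scalerA => /eqP.
  rewrite -subr_eq0 -scalerBl scaler_eq0 (negPf (v0 _ _ ghi)) orbF subr_eq0.
  by move/eqP => E1; apply: (mulIf (c0 g h i)); rewrite E1; field.
exists (fun g => of_coor (u g)) => [g|g h].
  by apply/(is_unit_coor S) => i; rewrite of_coorK.
apply: (@coor_inj _ _ _ _ S) => i; rewrite !coorM coor_act !of_coorK -uE.
by field.
Qed.

Lemma affords_iso E E' c : ext_iso E E' -> affords E c -> affords E' c.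
Proof.
move=> [f [[f_hom f_bij] f_gr f_act f_emb]] [v [vf v0 vM vJ]].
exists (fun g i => f (v g i)); split=> [g i|g i gi|g h i gi hi|g h i gi].
- have /fiberP[vg vi] := vf g i; apply/fiberP; rewrite f_gr //; split=> //.
  by rewrite -f_emb -(fhomM f_hom) vi.
- by apply: contraNneq (v0 g i gi) => fv; apply/eqP/(bij_inj f_bij);
  rewrite fv (fhom0 f_hom).
- by rewrite -(fhomM f_hom) vM // (fhomZ f_hom).
- by rewrite -f_act -(fhomZ f_hom) vJ // (fhomZ f_hom).
Qed.

(** Generators of the fibres over the orbit roots multiply through 2-cocycles [al] of the
    stabilisers of the roots. Pulling these back along [retract] gives the cocycle, and transporting
    the generators by [transl] gives the frame. *)
Lemma affords_exists (E : crossedExt rho) :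
  strict E -> exists2 c, cocycle2 rho c & affords E c.
Proof.
move=> /(strict_fibers S) E_fib.
have /choice[u' u'E] : forall p : G * 'I_(npt S), exists a : E,
    a \in fiber E p.1 p.2 /\ (p.1 • p.2 = p.2 -> a != 0).
  move=> [g i] /=; have [/E_fib[a ai a0]|/eqP gi] := eqVneq (g • i) i.
    by exists a.
  by exists 0; split=> [|//]; exact: fiber0.
pose u g i := u' (g, i).
have uf g i : u g i \in fiber E g i by have [] := u'E (g, i).
have u0 g i : g • i = i -> u g i != 0 by have [_] := u'E (g, i).
(* Away from the stabiliser of the point the value 1 is a default that keeps [al] nonzero. *)
have /choice[al' al'E] : forall p : G * G * 'I_(npt S), exists k : C,
    k != 0 /\ (p.1.1 • p.2 = p.2 -> p.1.2 • p.2 = p.2 ->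
      u p.1.1 p.2 * u p.1.2 p.2 = k *: u (p.1.1 * p.1.2)%g p.2).
  move=> [[g h] i] /=; have [gi|/eqP gi] := eqVneq (g • i) i; last first.
    by exists 1; rewrite oner_eq0.
  have [hi|/eqP hi] := eqVneq (h • i) i; last by exists 1; rewrite oner_eq0.
  have ghi := ptactMfix gi hi.
  have [k kE] := fiber_dim1 (uf _ _) (u0 _ _ ghi) (fiberM (uf g i) (uf h i)).
  exists k; split=> //; apply: contraNneq (fiberM_neq0 (uf g i) (uf h i)
    (u0 _ _ gi) (u0 _ _ hi)) => k0; by rewrite kE k0 scale0r.
pose al g h i := al' (g, h, i).
have al0 g h i : al g h i != 0 by have [] := al'E (g, h, i).
have alE g h i : g • i = i -> h • i = i ->
    u g i * u h i = al g h i *: u (g * h)%g i by have [_] := al'E (g, h, i).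
have al_coc g h k i : g • i = i -> h • i = i -> k • i = i ->
    al h k i * al g (h * k)%g i = al (g * h)%g k i * al g h i.
  move=> gi hi ki; have hki := ptactMfix hi ki; have ghi := ptactMfix gi hi.
  have := mulrA (u g i) (u h i) (u k i).
  rewrite (alE h k) // fdZr (alE g (h * k)%g) // (alE g h) // fdZl.
  rewrite (alE (g * h)%g k) // !scalerA mulgA => /eqP.
  rewrite -subr_eq0 -scalerBl scaler_eq0 (negPf (u0 _ _ (ptactMfix ghi ki))).
  by rewrite orbF subr_eq0 mulrC => /eqP ->; rewrite mulrC.
pose t := transl (S := S); pose r := orbit_root (S := S).
pose c g h := of_coor (S := S)
  (fun k => al (retract g k) (retract h (g^-1%g • k)) (r k)).
have rE g i : r (g • i) = r i by exact: orbit_root_act.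
have retf g i k : r i = r k -> retract g i • r k = r k.
  by move=> <-; exact: retract_fix.
exists c.
  split=> [g h|g h k]; first by apply/(is_unit_coor S) => i; rewrite of_coorK.
  apply: (@coor_inj _ _ _ _ S) => l.
  rewrite !coorM coor_act !of_coorK !retractM rE.
  by rewrite invMg ptactM al_coc // retf // !rE.
exists (fun g i => cact E (t i) (u (g ^ t i)%g (r i))).
have tf g i : g • i = i -> (g ^ t i)%g • r i = r i.
  by move=> gi; rewrite -retract_stab // retf.
have act_hom g := gact_hom (cact E) g.
split=> [g i|g i gi|g h i gi hi|g h i gi].
- have := fiber_act (t i) (uf (g ^ t i)%g (r i)).
  by rewrite translE conjgE !mulgA mulgV mul1g mulgK.
- exact/act_neq0/u0/tf.
- rewrite -(fhomM (act_hom _)) alE ?tf // (fhomZ (act_hom _)) of_coorK.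
  by rewrite ptactVfix // !retract_stab // conjMg.
rewrite !of_coorK ptactK (ptactVfix (ptactJfix _ gi)) rE.
rewrite (retract_stab (ptactJfix _ gi)) (retract_stab gi).
set s := retract h (h • i); set x := (g ^ t i)%g.
have sr : s • r i = r i by apply: retf; rewrite rE.
have xr : x • r i = r i by exact: tf.
have sE : s = ((t (h • i))^-1 * h * t i)%g by rewrite /s /retract ptactK.
have -> : ((h * g * h^-1) ^ t (h • i) = s * x * s^-1)%g.
  by rewrite sE /x !conjgE !invMg !invgK !mulgA !mulgK.
rewrite -Defs.gactM; have -> : (h * t i = t (h • i) * s)%g.
  by rewrite sE !mulgA mulgV mul1g.
rewrite Defs.gactM -!(fhomZ (act_hom (t (h • i)))); congr (cact E _ _).
have sxs : (s * x * s^-1)%g • r i = r i.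
  by rewrite ptactMfix ?ptactVfix // ptactMfix.
(* Both sides lie in one fibre over the root, so they may be compared after right multiplication by
   [u s (r i)]; the crossing relation then replaces the action of [s] by left multiplication with
   that generator. *)
apply: (@fiber_mulIr _ _ _ _ S E (s * x * s^-1)%g (s * x * s^-1)%g s (r i) _ _
  (u s (r i))).
- by apply: fiberZ; rewrite -{2}sr; exact/fiber_act/uf.
- exact/fiberZ/uf.
- exact: uf.
- exact: u0.
have /fiberP[us _] := uf s (r i).
rewrite !fdZl -(cact_cross _ us) !alE // mulgVK !scalerA.
by congr (_ *: _); ring.
Qed.

End Frames.

(** * Isomorphism of extensions that afford the same cocycle *)

Section FrameBasis.
Variables (G : finGroupType) (C : numClosedFieldType) (R : frobStarAlg C).
Variables (rho : frobAction G R) (S : spectrum rho) (c : G -> G -> R).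
Notation e := (idem S).
Notation x_ := (coor S).
Notation "g • i" := (ptact S g i) (at level 38, right associativity).

Section OneFrame.
Variables (E : crossedExt rho) (v : G -> 'I_(npt S) -> E).
Hypothesis v_frame : frame c v.
Notation eps i := (ext_emb E (e i)).

Lemma frame_fiber g i : v g i \in fiber E g i.
Proof. by case: v_frame. Qed.

Lemma frame_neq0 g i : g • i = i -> v g i != 0.
Proof. by case: v_frame => _ v0 _ _; exact: v0. Qed.

Lemma frame_eq0 g i : g • i != i -> v g i = 0.
Proof. by apply: contra_neq_eq => /(fiber_fix (frame_fiber g i)). Qed.

(** [v 1 i] is a nonzero multiple [k] of the idempotent [eps i], and the multiplication rule for its
    square reads [k * k = x_ i (c 1 1) * k]. *)
Lemma frame_one i : v 1%g i = x_ i (c 1%g 1%g) *: eps i.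
Proof.
have i1 := ptact1 i; have [k kE] := fiber1 (frame_fiber 1%g i).
have v0 := frame_neq0 i1; have k0 : k != 0.
  by apply: contraNneq v0 => k0; rewrite kE k0 scale0r.
case: v_frame => _ _ /(_ 1%g 1%g i i1 i1); rewrite mulg1 kE fdZl fdZr epsM eqxx.
by rewrite !scalerA => /eqP; rewrite -subr_eq0 -scalerBl scaler_eq0 (negPf
  (eps_neq0 E i)) orbF subr_eq0 => /eqP/(mulIf k0) <-.
Qed.

Lemma fiber_frame g i a : a \in fiber E g i -> exists k, a = k *: v g i.
Proof.
move=> ai; have [gi|gi] := eqVneq (g • i) i.
  by apply: fiber_dim1 (frame_fiber g i) (frame_neq0 gi) ai.
exists 0; rewrite scale0r; apply/eqP; apply: contraNT gi => a0.
by apply/eqP/(fiber_fix ai).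
Qed.

Lemma frame_linear_ext (T : lmodType C) (f1 f2 : E -> T) :
  linear f1 -> linear f2 -> (forall g i, f1 (v g i) = f2 (v g i)) -> f1 =1 f2.
Proof.
move=> l1 l2 f12 a; have [k [kf ->]] := sum_fibers S a.
pose F1 : {linear _ -> _} := HB.pack f1 (GRing.isLinear.Build _ _ _ _ f1 l1).
pose F2 : {linear _ -> _} := HB.pack f2 (GRing.isLinear.Build _ _ _ _ f2 l2).
rewrite -[LHS]/(F1 _) -[RHS]/(F2 _) !linear_sum; apply: eq_bigr => g _.
rewrite !linear_sum; apply: eq_bigr => i _.
by have [l ->] := fiber_frame (kf g i); rewrite !linearZ /= f12.
Qed.

Definition frame_norm g i : C := lambda (v g i * star (v g i)) / lambda (e i).

Lemma frame_normE g i : v g i * star (v g i) = frame_norm g i *: eps i.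
Proof. exact: fiber_norm (frame_fiber g i). Qed.

Lemma frame_norm_gt0 g i : g • i = i -> 0 < frame_norm g i.
Proof.
by move=> gi; apply: fiber_norm_gt0 (frame_fiber g i) (frame_neq0 gi).
Qed.

Lemma frame_normM g h i : g • i = i -> h • i = i ->
  frame_norm g i * frame_norm h i =
  x_ i (c g h) * (x_ i (c g h))^* * frame_norm (g * h)%g i.
Proof.
move=> gi hi; case: v_frame => _ _ vM _.
have /fiberP[_ vi] := frame_fiber g i.
have : v g i * v h i * star (v g i * v h i) =
    (frame_norm g i * frame_norm h i) *: eps i.
  rewrite starM mulrA -(mulrA (v g i)) frame_normE fdZr vi fdZl frame_normE.
  by rewrite scalerA mulrC.
rewrite vM // starZ fdZl fdZr frame_normE !scalerA => /eqP.
rewrite -subr_eq0 -scalerBl scaler_eq0 (negPf (eps_neq0 E i)) orbF subr_eq0.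
by move/eqP.
Qed.

(** The star of [v g i] is a multiple of [v g^-1 i]; multiplying on the left by [v g i] and using
    [frame_one] determines the multiple. *)
Lemma frame_star g i : g • i = i ->
  x_ i (c g g^-1%g) * x_ i (c 1%g 1%g) *: star (v g i) =
  frame_norm g i *: v g^-1%g i.
Proof.
move=> gi; case: v_frame => _ _ vM _; have gVi := ptactVfix gi.
have [k kE] := fiber_frame (fiber_star (frame_fiber g i)).
have := frame_normE g i; rewrite kE fdZr vM // mulgV frame_one !scalerA => /eqP.
rewrite -subr_eq0 -scalerBl scaler_eq0 (negPf (eps_neq0 E i)) orbF subr_eq0.
by move=> /eqP <-; congr (_ *: _); ring.
Qed.

(** The Fourier coefficient of [a] for the positive form and the orthogonal family [v]; it is 0 when
    [g] moves [i], where [v g i] is 0. *)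
Definition frame_coor g i (a : E) : C :=
  lambda (a * star (v g i)) / lambda (v g i * star (v g i)).

Lemma frame_coor_linear g i : scalar (frame_coor g i).
Proof.
move=> k a b; rewrite /frame_coor mulrDl fdZl linearD linearZ /= mulrDl.
by rewrite mulrA.
Qed.

Lemma frame_coorE g i h k : g • i = i ->
  frame_coor g i (v h k) = ((g, i) == (h, k))%:R.
Proof.
move=> gi; case: eqVneq => [[<- <-]|ghik].
  by rewrite /frame_coor divff // gt_eqF // form_posdef // frame_neq0.
rewrite /frame_coor (lambda_orthogonal _ (frame_fiber h k) (frame_fiber g i)).
  by rewrite mul0r.
by rewrite eq_sym.
Qed.

Lemma frame_coor0 g i a : g • i != i -> frame_coor g i a = 0.
Proof.
by move=> gi; rewrite /frame_coor frame_eq0 // mul0r linear0 invr0 mulr0.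
Qed.

End OneFrame.

Section TwoFrames.
Variables (E E' : crossedExt rho).
Variables (v : G -> 'I_(npt S) -> E) (v' : G -> 'I_(npt S) -> E').
Hypotheses (v_frame : frame c v) (v'_frame : frame c v').
Hypothesis c_cocycle : cocycle2 rho c.

Definition frame_map (a : E) : E' := \sum_g \sum_i frame_coor v g i a *: v' g i.

Lemma frame_map_linear : linear frame_map.
Proof.
move=> k a b; rewrite /frame_map scaler_sumr -big_split; apply: eq_bigr => g _.
rewrite scaler_sumr -big_split; apply: eq_bigr => i _ /=.
by rewrite frame_coor_linear scalerDl scalerA.
Qed.

Lemma frame_mapE g i : frame_map (v g i) = v' g i.
Proof.
have [gi|gi] := eqVneq (g • i) i; last first.
  rewrite (frame_eq0 v_frame gi) (frame_eq0 v'_frame gi) /frame_map.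
  rewrite big1 // => h _; rewrite big1 // => k _.
  by rewrite /frame_coor mul0r linear0 mul0r scale0r.
rewrite /frame_map (bigD1 g) //= (bigD1 i) //= (frame_coorE v_frame) // eqxx.
rewrite scale1r big1 => [|k ki].
  rewrite addr0 big1 ?addr0 // => h hg; rewrite big1 // => k _.
  have [hk|hk] := eqVneq (h • k) k.
    by rewrite (frame_coorE v_frame) // xpair_eqE (negPf hg) scale0r.
  by rewrite (frame_coor0 v_frame) // scale0r.
have [gk|gk] := eqVneq (g • k) k.
  by rewrite (frame_coorE v_frame) // xpair_eqE (negPf ki) andbF scale0r.
by rewrite (frame_coor0 v_frame) // scale0r.
Qed.

(* The ratio of the two norms is a homomorphism from the finite stabiliser of
   [i] to the positive reals. *)
Lemma frame_norm_eq g i : g • i = i -> frame_norm v g i = frame_norm v' g i.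
Proof.
move=> gi; pose q h := frame_norm v' h i / frame_norm v h i.
have q0 h : h • i = i -> 0 < q h by move=> hi; rewrite divr_gt0 ?frame_norm_gt0.
have qM h k : h • i = i -> k • i = i -> q (h * k)%g = q h * q k.
  move=> hi ki; have hki := ptactMfix hi ki.
  have cc0 : x_ i (c h k) * (x_ i (c h k))^* != 0.
    by rewrite mulf_neq0 ?conjC_eq0 //; exact: cocycle_neq0.
  rewrite /q mulf_div (frame_normM v_frame) // (frame_normM v'_frame) //.
  by rewrite -[RHS]mulf_div divff // mul1r.
have i1 := ptact1 i.
have q1 : q 1%g = 1.
  apply: (mulIf (lt0r_neq0 (q0 _ i1))).
  by rewrite -qM // mulg1 mul1r.
have qX n : (g ^+ n)%g • i = i /\ q (g ^+ n)%g = q g ^+ n.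
  elim: n => [|n [gni qn]]; first by rewrite expg0 expr0.
  by rewrite expgS exprS qM // qn ptactMfix.
have [_] := qX #[g]%g; rewrite expg_order q1 => /esym/eqP.
rewrite pexpr_eq1 ?order_gt0 ?ltW ?q0 // => /eqP qg.
by rewrite -[LHS]mul1r -qg divfK // lt0r_neq0 // (frame_norm_gt0 v_frame).
Qed.


Lemma frame_map0 : frame_map 0 = 0.
Proof.
rewrite /frame_map big1 // => h _; rewrite big1 // => l _.
by rewrite /frame_coor mul0r linear0 mul0r scale0r.
Qed.

Lemma frame_mapZ k a : frame_map (k *: a) = k *: frame_map a.
Proof.
by have := frame_map_linear k a 0; rewrite frame_map0 !addr0.
Qed.

Lemma frame_mapD a b : frame_map (a + b) = frame_map a + frame_map b.
Proof. by have := frame_map_linear 1 a b; rewrite !scale1r. Qed.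

(** A further star makes the two conjugate-linear sides linear, so it is enough to compare them on
    the frame. There [frame_star] reduces the claim to the equality of norms. *)
Lemma frame_map_star a : frame_map (star a) = star (frame_map a).
Proof.
suff : star (frame_map (star a)) = frame_map a by move=> <-; rewrite starK.
move: a; apply: (frame_linear_ext v_frame) => [k a b||g i].
- by rewrite starD starZ frame_map_linear starD starZ conjCK.
- exact: frame_map_linear.
have [gi|gi] := eqVneq (g • i) i; last first.
  rewrite frame_mapE (frame_eq0 v_frame gi) (frame_eq0 v'_frame gi) star0.
  by rewrite frame_map0 star0.
have d0 : x_ i (c g g^-1%g) * x_ i (c 1%g 1%g) != 0.
  by rewrite mulf_neq0 //; exact: cocycle_neq0.
rewrite frame_mapE -[RHS]starK; congr (star _); apply: (scalerI d0).
rewrite -frame_mapZ (frame_star v_frame) // (frame_star v'_frame) //.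
by rewrite frame_mapZ frame_mapE frame_norm_eq.
Qed.

Lemma frame_map_emb r : frame_map (ext_emb E r) = ext_emb E' r.
Proof.
have eE i : frame_map (ext_emb E (e i)) = ext_emb E' (e i).
  have c0 : x_ i (c 1%g 1%g) != 0 by exact: cocycle_neq0.
  apply: (scalerI c0); rewrite -frame_mapZ -(frame_one v_frame) frame_mapE.
  by rewrite (frame_one v'_frame).
rewrite -(coorK S r) (fhom_sum (ext_emb_hom E)) (fhom_sum (ext_emb_hom E')).
rewrite (big_morph _ frame_mapD frame_map0); apply: eq_bigr => i _.
rewrite (fhomZ (ext_emb_hom E)) (fhomZ (ext_emb_hom E')).
by rewrite frame_mapZ eE.
Qed.

Lemma frame_map_hom : frob_hom frame_map.
Proof.
split; last exact: frame_map_star; first exact: frame_map_linear.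
- split.
    by rewrite -(fhom1 (ext_emb_hom E)) frame_map_emb (fhom1 (ext_emb_hom E')).
  move=> a b; move: a; apply: (frame_linear_ext v_frame) => [k a a'|k a a'|g i].
  + by rewrite mulrDl fdZl frame_map_linear.
  + by rewrite frame_map_linear mulrDl fdZl.
  move: b; apply: (frame_linear_ext v_frame) => [k b b'|k b b'|h k].
  + by rewrite mulrDr fdZr frame_map_linear.
  + by rewrite frame_map_linear mulrDr fdZr.
  rewrite !frame_mapE; have vf := frame_fiber v_frame.
  have v'f := frame_fiber v'_frame; have [<-{k}|ik] := eqVneq i k; last first.
    rewrite (fiberM_eq0 ik (vf g i) (vf h k)) frame_map0.
    by rewrite (fiberM_eq0 ik (v'f g i) (v'f h k)).
  have [gi|gi] := eqVneq (g • i) i; last first.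
    by rewrite (frame_eq0 v_frame gi) (frame_eq0 v'_frame gi) !mul0r frame_map0.
  have [hi|hi] := eqVneq (h • i) i; last first.
    by rewrite (frame_eq0 v_frame hi) (frame_eq0 v'_frame hi) !mulr0 frame_map0.
  case: v_frame => _ _ -> // _; case: v'_frame => _ _ -> // _.
  by rewrite frame_mapZ frame_mapE.
- apply: (@frame_linear_ext _ _ v_frame C^o) => [k a b|k a b|g i].
  + by rewrite frame_map_linear linearD linearZ.
  + by rewrite linearD linearZ.
  rewrite frame_mapE; have [->|g1] := eqVneq g 1%g.
    rewrite (frame_one v_frame) (frame_one v'_frame) !lambdaZ.
    by rewrite !lambda_eps.
  have /fiberP[vg _] := frame_fiber v_frame g i.
  have /fiberP[v'g _] := frame_fiber v'_frame g i.
  by rewrite (comp_lambda g1 vg) (comp_lambda g1 v'g).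
Qed.

Lemma frame_map_act h a : frame_map (cact E h a) = cact E' h (frame_map a).
Proof.
have h_hom := gact_hom (cact E) h; have h'_hom := gact_hom (cact E') h.
move: a; apply: (frame_linear_ext v_frame) => [k a b|k a b|g i].
- by rewrite (fhomD h_hom) (fhomZ h_hom) frame_map_linear.
- by rewrite frame_map_linear (fhomD h'_hom) (fhomZ h'_hom).
rewrite frame_mapE; have [gi|gi] := eqVneq (g • i) i; last first.
  rewrite (frame_eq0 v_frame gi) (frame_eq0 v'_frame gi).
  by rewrite (fhom0 h_hom) (fhom0 h'_hom) frame_map0.
have c0 : x_ (h • i) (c (h * g * h^-1)%g h) != 0 by exact: cocycle_neq0.
apply: (scalerI c0); rewrite -frame_mapZ.
case: v_frame => _ _ _ -> //; case: v'_frame => _ _ _ -> //.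
by rewrite frame_mapZ frame_mapE.
Qed.

Lemma frame_map_comp g a : a \in hcomp E g -> frame_map a \in hcomp E' g.
Proof.
move=> ag; apply: memv_suml => h _; apply: memv_suml => i _.
have [<-|hg] := eqVneq g h.
  by apply: memvZ; have /fiberP[] := frame_fiber v'_frame g i.
have -> : frame_coor v h i a = 0; last by rewrite scale0r mem0v.
have /fiberP[vh _] := frame_fiber v_frame h i.
rewrite /frame_coor (@comp_lambda _ _ E (g * h^-1)%g) ?mul0r //.
  by rewrite eq_mulgV1 in hg.
exact/comp_mul/comp_starV.
Qed.

End TwoFrames.

Lemma frame_mapK (E E' : crossedExt rho) (v : G -> 'I_(npt S) -> E)
    (v' : G -> 'I_(npt S) -> E') : frame c v -> frame c v' ->
  cancel (frame_map v v') (frame_map v' v).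
Proof.
move=> vF v'F; apply: (frame_linear_ext vF) => [k a b|//|g i].
  by rewrite !frame_map_linear.
by rewrite (frame_mapE vF v'F) (frame_mapE v'F vF).
Qed.

Lemma affords_ext_iso (E E' : crossedExt rho) : cocycle2 rho c ->
  affords S E c -> affords S E' c -> ext_iso E E'.
Proof.
move=> cC [v vF] [v' v'F]; exists (frame_map v v'); split.
- split; first exact: frame_map_hom.
  by exists (frame_map v' v); exact: frame_mapK.
- exact: frame_map_comp.
- exact: frame_map_act.
- exact: frame_map_emb.
Qed.

End FrameBasis.

(** * The centraliser of the base in a twisted crossed product *)

Section TwistedInertia.
Variables (G : finGroupType) (C : numClosedFieldType) (R : frobStarAlg C).
Variables (rho : frobAction G R) (S : spectrum rho).
Variable c : G -> G -> 'I_(npt S) -> C.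
Notation e := (idem S).
Notation x_ := (coor S).
Notation "g • i" := (ptact S g i) (at level 38, right associativity).
Hypothesis c_cocycle : forall g h k i,
  c h k (g^-1%g • i) * c g (h * k)%g i = c (g * h)%g k i * c g h i.
Hypothesis c_unitary : forall g h i, c g h i * (c g h i)^* = 1.
Hypothesis c11 : forall i, c 1%g 1%g i = 1.

Lemma ucocycle_neq0 g h i : c g h i != 0.
Proof.
by apply/eqP => c0; have /eqP := c_unitary g h i;
  rewrite c0 mul0r eq_sym oner_eq0.
Qed.

Lemma ucocycle1g g i : c 1%g g i = 1.
Proof.
apply: (mulIf (ucocycle_neq0 1%g g i)); have := c_cocycle 1%g 1%g g i.
by rewrite !mul1g invg1 ptact1 c11 mulr1 mul1r.
Qed.

Lemma ucocycleg1 g i : c g 1%g i = 1.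
Proof.
apply: (mulIf (ucocycle_neq0 g 1%g i)); have := c_cocycle g 1%g 1%g i.
by rewrite !mulg1 c11 => <-.
Qed.

Lemma ucocycle_conj g h i : (c g h i)^* = (c g h i)^-1.
Proof.
by apply: (mulfI (ucocycle_neq0 g h i)); rewrite c_unitary divff ?ucocycle_neq0.
Qed.

Lemma ucocycle_stab g h k i : g • i = i ->
  c h k i * c g (h * k)%g i = c (g * h)%g k i * c g h i.
Proof. by move=> /ptactVfix gi; rewrite -c_cocycle gi. Qed.

(** The isotropy of the action groupoid: arrows from a point to itself. *)
Definition inertia := {p : G * 'I_(npt S) | p.1 • p.2 == p.2}.
HB.instance Definition _ := Finite.on inertia.

(* [a g i] is the coefficient of [e_i w_g] in the crossed product, which
   centralises R exactly when [g] fixes [i]. *)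
Definition twisted := {ffun inertia -> C^o}.
HB.instance Definition _ := Vector.on twisted.

(** Coefficients are extended by 0 outside [inertia], so that sums may run over all of [G]. *)
Definition tco (a : twisted) g i : C :=
  oapp (fun p => a p) 0 (insub (g, i) : option inertia).
Definition tmk (F : G -> 'I_(npt S) -> C) : twisted :=
  [ffun p => F (val p).1 (val p).2].

Lemma tcoK F g i : tco (tmk F) g i = if g • i == i then F g i else 0.
Proof.
rewrite /tco; case: insubP => [p /= -> pE|/negPf /= -> //].
by rewrite /= ffunE; have -> : val p = (g, i) by exact: pE.
Qed.

Lemma tco_eq0 a g i : g • i != i -> tco a g i = 0.
Proof. by move=> gi; rewrite /tco insubF //= (negPf gi). Qed.

Lemma tcoK0 F g i : (g • i != i -> F g i = 0) -> tco (tmk F) g i = F g i.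
Proof. by move=> F0; rewrite tcoK; case: eqVneq => // /F0 ->. Qed.

Lemma tco_inj a b : (forall g i, g • i = i -> tco a g i = tco b g i) -> a = b.
Proof.
move=> ab; apply/ffunP => p; have := ab (val p).1 (val p).2 (eqP (valP p)).
by rewrite /tco -surjective_pairing valK.
Qed.

Lemma tcoD a b g i : tco (a + b) g i = tco a g i + tco b g i.
Proof.
by rewrite /tco; case: insubP => [p _ _|_] /=; rewrite ?addr0 // ffunE.
Qed.

Lemma tcoZ k a g i : tco (k *: a) g i = k * tco a g i.
Proof.
by rewrite /tco; case: insubP => [p _ _|_] /=; rewrite ?mulr0 // ffunE.
Qed.

Lemma tco0 g i : tco 0 g i = 0.
Proof. by rewrite /tco; case: insubP => [p _ _|_] //=; rewrite ffunE. Qed.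

Definition tone := tmk (fun g i => (g == 1%g)%:R).

Lemma tco1 g i : tco tone g i = (g == 1%g)%:R.
Proof.
by rewrite tcoK0 //; case: (eqVneq g 1%g) => [->|//]; rewrite ptact1 eqxx.
Qed.

Definition tmul (a b : twisted) := tmk (fun g i =>
  \sum_h tco a h i * tco b (h^-1 * g)%g i * c h (h^-1 * g)%g i).

Lemma tcoM a b g i : tco (tmul a b) g i =
  \sum_h tco a h i * tco b (h^-1 * g)%g i * c h (h^-1 * g)%g i.
Proof.
rewrite tcoK0 // => gi; rewrite big1 // => h _.
have [hi|hi] := eqVneq (h • i) i; last by rewrite tco_eq0 // !mul0r.
rewrite (@tco_eq0 b) ?mulr0 ?mul0r //; apply: contra_neq gi => hgi.
by rewrite -{2}hi -{2}hgi -ptactM mulKVg.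
Qed.

(** The cocycle identity at [(k, l, l^-1 * (k^-1 * g))]. The translate of [i] in it disappears,
    because the coefficient of [a] at [k] vanishes unless [k] fixes [i]. *)
Lemma tmulA : associative tmul.
Proof.
move=> a b d; apply: tco_inj => g i gi; rewrite !tcoM.
under eq_bigr do rewrite tcoM mulr_sumr mulr_suml.
under [RHS]eq_bigr do rewrite tcoM !mulr_suml.
rewrite [RHS]exchange_big /=; apply: eq_bigr => k _.
rewrite [RHS](reindex_inj (mulgI k)) /=; apply: eq_bigr => l _.
rewrite mulKg invMg -mulgA.
have [ki|ki] := eqVneq (k • i) i; last by rewrite (@tco_eq0 a) // !mul0r.
have := ucocycle_stab l (l^-1 * (k^-1 * g))%g ki; rewrite mulKVg => H.
transitivity (tco a k i * tco b l i * tco d (l^-1 * (k^-1 * g))%g i *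
  (c l (l^-1 * (k^-1 * g))%g i * c k (k^-1 * g)%g i)); first by ring.
by rewrite H; ring.
Qed.

Lemma tmul1 : left_id tone tmul.
Proof.
move=> a; apply: tco_inj => g i gi; rewrite tcoM (big_only1 1%g) //.
  by rewrite tco1 eqxx mul1r invg1 mul1g ucocycle1g mulr1.
by move=> h h1 _; rewrite tco1 (negPf h1) !mul0r.
Qed.

Lemma tmulr1 : right_id tone tmul.
Proof.
move=> a; apply: tco_inj => g i gi; rewrite tcoM (big_only1 g) //.
  by rewrite mulVg tco1 eqxx mulr1 ucocycleg1 mulr1.
move=> h hg _; rewrite tco1 -eq_mulVg1 (negPf hg).
by rewrite mulr0 mul0r.
Qed.

Lemma tmulDl : left_distributive tmul +%R.
Proof.
move=> a b d; apply: tco_inj => g i gi; rewrite tcoD !tcoM -big_split.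
by apply: eq_bigr => h _ /=; rewrite tcoD !mulrDl.
Qed.

Lemma tmulDr : right_distributive tmul +%R.
Proof.
move=> a b d; apply: tco_inj => g i gi; rewrite tcoD !tcoM -big_split.
by apply: eq_bigr => h _ /=; rewrite tcoD mulrDr !mulrDl.
Qed.

Lemma tscaleAl k a b : k *: tmul a b = tmul (k *: a) b.
Proof.
apply: tco_inj => g i gi; rewrite tcoZ !tcoM mulr_sumr.
by apply: eq_bigr => h _; rewrite tcoZ !mulrA.
Qed.

Lemma tscaleAr k a b : k *: tmul a b = tmul a (k *: b).
Proof.
apply: tco_inj => g i gi; rewrite tcoZ !tcoM mulr_sumr.
by apply: eq_bigr => h _; rewrite tcoZ; ring.
Qed.

Definition twisted_alg : fdAlg C :=
  @FdAlg C twisted tone tmul tmulA tmul1 tmulr1 tmulDl tmulDr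
    tscaleAl tscaleAr.

Definition tlam (a : twisted_alg) : C := \sum_i tco a 1%g i * lambda (e i).

Lemma tlam_linear : scalar tlam.
Proof.
move=> k a b; rewrite /tlam mulr_sumr -big_split; apply: eq_bigr => i _ /=.
by rewrite tcoD tcoZ mulrDl mulrA.
Qed.

Definition tlambda : {scalar twisted_alg} :=
  HB.pack tlam (GRing.isLinear.Build _ _ _ _ tlam tlam_linear).

(** The star for which each [w_g] is unitary: the inverse of [w_(g^-1)] is [w_g] divided by
    [c g g^-1], and dividing by a number of modulus 1 is multiplying by its conjugate. *)
Definition tstar (a : twisted_alg) : twisted_alg := tmk (fun g i =>
  (tco a g^-1%g i * c g g^-1%g i)^*).

Lemma tco_star a g i : tco (tstar a) g i = (tco a g^-1%g i * c g g^-1%g i)^*.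
Proof.
rewrite tcoK0 // => gi; rewrite tco_eq0 ?mul0r ?conjC0 //.
by apply: contra_neq gi => /ptactVfix; rewrite invgK.
Qed.

Lemma ucocycleVC g i : g • i = i -> c g g^-1%g i = c g^-1%g g i.
Proof.
move=> gi; have := ucocycle_stab g^-1%g g gi.
by rewrite mulVg mulgV ucocycleg1 ucocycle1g mulr1 mul1r.
Qed.

Lemma tlambda_class (a b : twisted_alg) : tlambda (a * b) = tlambda (b * a).
Proof.
apply: eq_bigr => i _; congr (_ * _); rewrite [LHS]tcoM [RHS]tcoM.
rewrite [RHS](reindex_inj invg_inj); apply: eq_bigr => h _ /=.
rewrite !mulg1 invgK; have [hi|hi] := eqVneq (h • i) i.
  by rewrite ucocycleVC //; ring.
by rewrite (@tco_eq0 a h) // !(mul0r, mulr0).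
Qed.

Lemma tstarD a b : tstar (a + b) = tstar a + tstar b.
Proof.
apply: tco_inj => g i gi; rewrite tcoD !tco_star tcoD mulrDl.
exact: rmorphD.
Qed.

Lemma tstarZ (k : C) a : tstar (k *: a) = k^* *: tstar a.
Proof.
apply: tco_inj => g i gi; rewrite tcoZ !tco_star tcoZ -mulrA.
exact: rmorphM.
Qed.

Lemma tstarK : involutive tstar.
Proof.
move=> a; apply: tco_inj => g i gi; rewrite !tco_star invgK.
rewrite -ucocycleVC // !rmorphM /= !conjCK -mulrA.
by rewrite c_unitary mulr1.
Qed.

Lemma tstarM (a b : twisted_alg) : tstar (a * b) = tstar b * tstar a.
Proof.
apply: tco_inj => g i gi; rewrite tco_star.
rewrite [tco (a * b) _ _]tcoM [RHS]tcoM mulr_suml rmorph_sum /=.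
rewrite [RHS](reindex_inj (mulgI g)); apply: eq_bigr => h _ /=.
rewrite !tco_star !invMg !invgK -!mulgA mulVg mulg1 mulKg.
have [hi|hi] := eqVneq (h • i) i; last first.
  by rewrite (@tco_eq0 a h) // !(mul0r, mulr0, conjC0).
(* The cocycle identity at [(g, h, h^-1 * g^-1)] and at [(g, h, h^-1)]. *)
have H1 := ucocycle_stab h (h^-1 * g^-1)%g gi; rewrite mulKVg in H1.
have H2 := ucocycle_stab h h^-1%g gi; rewrite mulgV ucocycleg1 mulr1 in H2.
rewrite !rmorphM /= !ucocycle_conj -(ucocycleVC hi) H2.
have H3 : (c h (h^-1 * g^-1)%g i)^-1 * (c g g^-1%g i)^-1 =
  (c (g * h)%g (h^-1 * g^-1)%g i)^-1 * (c g h i)^-1 by rewrite -!invfM H1.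
rewrite -!mulrA H3; field.
by rewrite !ucocycle_neq0.
Qed.

Lemma lambda_idem_real i : (lambda (e i))^* = lambda (e i).
Proof. by apply/CrealP/gtr0_real/lambda_idem_gt0. Qed.

Lemma tlambda_star a : tlambda (tstar a) = (tlambda a)^*.
Proof.
rewrite [RHS]rmorph_sum; apply: eq_bigr => i _ /=.
by rewrite tco_star invg1 c11 mulr1 rmorphM /= lambda_idem_real.
Qed.

(** Since [c] is unitary, the form at [a] is the sum of the squared moduli of the coefficients of
    [a], weighted by the positive numbers [lambda (e i)]. *)
Lemma tform_posdef (a : twisted_alg) : a != 0 -> 0 < tlambda (a * tstar a).
Proof.
have aaE i : tco (a * tstar a) 1%g i = \sum_h `|tco a h i| ^+ 2.
  rewrite [LHS]tcoM; apply: eq_bigr => h _; rewrite mulg1 tco_star invgK.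
  rewrite normCK rmorphM /= -!mulrA; have [hi|hi] := eqVneq (h • i) i.
    by rewrite -ucocycleVC // [_^* * c _ _ _]mulrC c_unitary mulr1.
  by rewrite (@tco_eq0 a h) // !mul0r.
have aa_ge0 i : 0 <= tco (a * tstar a) 1%g i.
  by rewrite aaE sumr_ge0 // => h _; rewrite exprn_ge0.
move=> a0; have ge0 : 0 <= tlambda (a * tstar a).
  by rewrite sumr_ge0 // => i _; rewrite mulr_ge0 // ltW // lambda_idem_gt0.
rewrite lt0r ge0 andbT; apply: contra_neq a0 => /eqP.
rewrite psumr_eq0 => [/allP aa0|i _]; last first.
  by rewrite mulr_ge0 // ltW // lambda_idem_gt0.
apply: tco_inj => g i gi; rewrite tco0.
have := aa0 i (mem_index_enum _); rewrite mulf_eq0 aaE.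
rewrite (gt_eqF (lambda_idem_gt0 i)) orbF psumr_eq0 => [/allP aa0i|h _].
  by have := aa0i g (mem_index_enum _); rewrite sqrf_eq0 normr_eq0 => /eqP.
exact: exprn_ge0.
Qed.

Definition twisted_frob : frobStarAlg C :=
  FrobStarAlg tlambda_class tstarD tstarZ tstarK tstarM tlambda_star
    tform_posdef.

Definition tproj g (a : twisted) : twisted :=
  tmk (fun h i => if h == g then tco a h i else 0).

Lemma tco_proj g a h i : tco (tproj g a) h i = if h == g then tco a h i else 0.
Proof. by rewrite tcoK0 // => hi; rewrite tco_eq0 // if_same. Qed.

(** The part of [a] outside degree [g]; it presents the homogeneous component as a kernel. *)
Definition toff g (a : twisted) : twisted := a - tproj g a.

Lemma toff_linear g : linear (toff g).
Proof.
move=> k a b; apply: tco_inj => h i hi.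
have tcoB (x y : twisted) : tco (x - y) h i = tco x h i - tco y h i.
  by rewrite tcoD -scaleN1r tcoZ mulN1r.
rewrite /toff [RHS]tcoD [in RHS]tcoZ !tcoB !tco_proj !tcoD !tcoZ.
by case: ifP => _; ring.
Qed.
HB.instance Definition _ g := GRing.isLinear.Build C twisted twisted _
  (toff g) (toff_linear g).

Definition tcomp g : {vspace twisted} :=
  lker (linfun (toff g)).

Lemma tcompP g a :
  reflect (forall h i, h != g -> tco a h i = 0) (a \in tcomp g).
Proof.
rewrite memv_ker lfunE /= /toff subr_eq0; apply: (iffP eqP) => [-> h i hg|a0].
  by rewrite tco_proj (negPf hg).
by apply: tco_inj => h i _; rewrite tco_proj; case: eqVneq => // /a0.
Qed.

Lemma tmk_comp g (F : 'I_(npt S) -> C) :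
  tmk (fun h i => if h == g then F i else 0) \in tcomp g.
Proof. by apply/tcompP => h i hg; rewrite tcoK (negPf hg) if_same. Qed.

Lemma tco_sum (I : finType) (F : I -> twisted) g i :
  tco (\sum_j F j) g i = \sum_j tco (F j) g i.
Proof.
exact: (big_morph (fun a => tco a g i) (fun a b => tcoD a b g i) (tco0 g i)).
Qed.

Lemma tcomp_full : (\sum_(g : G) tcomp g)%VS = fullv.
Proof.
apply/eqP; rewrite eqEsubv subvf /=; apply/subvP => a _.
have -> : a = \sum_g tproj g a.
  apply: tco_inj => g i _; rewrite tco_sum (big_only1 g) //.
    by rewrite tco_proj eqxx.
  by move=> h hg _; rewrite tco_proj eq_sym (negPf hg).
apply: memv_sumr => g _; apply/tcompP => h i hg.
by rewrite tco_proj (negPf hg).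
Qed.

Lemma tcomp_direct : directv (\sum_(g : G) tcomp g).
Proof.
apply/directv_sum_independent => us usP us0 g _; apply: tco_inj => h i _.
rewrite tco0; have [->|hg] := eqVneq h g; last first.
  by have /tcompP -> := usP g isT.
have := congr1 (fun a => tco a g i) us0.
rewrite tco_sum tco0 (big_only1 g) // => k kg _.
by have /tcompP -> := usP k isT; rewrite // eq_sym.
Qed.

Lemma tcomp_one : (1 : twisted_alg) \in tcomp 1%g.
Proof. by apply/tcompP => h i h1; rewrite [LHS]tco1 (negPf h1). Qed.

Lemma tcomp_mul g h (a b : twisted_alg) :
  a \in tcomp g -> b \in tcomp h -> a * b \in tcomp (g * h)%g.
Proof.
move=> /tcompP a0 /tcompP b0; apply/tcompP => k i kgh.
rewrite [LHS]tcoM big1 // => l _; have [lg|lg] := eqVneq l g; last first.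
  by rewrite a0 // !mul0r.
rewrite b0 ?mulr0 ?mul0r //; apply: contra_neq kgh => <-.
by rewrite lg mulKVg.
Qed.

Lemma tcomp_lambda g (a : twisted_frob) :
  g != 1%g -> a \in tcomp g -> lambda a = 0.
Proof.
move=> g1 /tcompP a0; apply: big1 => i _.
by rewrite a0 ?mul0r // eq_sym.
Qed.

Lemma tstar_comp g (a : twisted_frob) :
  a \in tcomp g -> star a \in tcomp g^-1%g.
Proof.
move=> /tcompP a0; apply/tcompP => h i hg.
rewrite [LHS]tco_star a0 ?mul0r ?conjC0 //; apply: contra_neq hg => <-.
by rewrite invgK.
Qed.

Lemma tcomp_star g (b : twisted_frob) :
  b \in tcomp g^-1%g <->
  exists2 a : twisted_frob, a \in tcomp g & b = star a.
Proof.
split=> [bg|[a ag ->]]; last exact: tstar_comp.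
exists (star b); last by rewrite starK.
by rewrite -[g]invgK; exact: tstar_comp.
Qed.

Definition twisted_graded : gradedFrob G C :=
  @GradedFrob G C twisted_frob tcomp tcomp_full tcomp_direct tcomp_one
    tcomp_mul tcomp_lambda tcomp_star.

(* Conjugation by [w_h] in the crossed product. *)
Definition tact (h : G) (a : twisted_frob) : twisted_frob := tmk (fun g i =>
  c h (g ^ h)%g i / c g h i * tco a (g ^ h)%g (h^-1%g • i)).

Lemma conj_fix g h i : g • i = i <-> (g ^ h)%g • h^-1%g • i = h^-1%g • i.
Proof.
rewrite conjgE !ptactM ptactVK; split=> [->//|/(congr1 (ptact S h))].
by rewrite !ptactVK.
Qed.

Lemma tco_act h a g i : tco (tact h a) g i =
  c h (g ^ h)%g i / c g h i * tco a (g ^ h)%g (h^-1%g • i).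
Proof.
rewrite tcoK0 // => gi; rewrite tco_eq0 ?mulr0 //.
by apply: contra_neq gi => /(conj_fix g h i).2.
Qed.

Lemma tact1 a : tact 1%g a = a.
Proof.
apply: tco_inj => g i gi; rewrite tco_act conjg1 invg1 ptact1.
by rewrite ucocycle1g ucocycleg1 divr1 mul1r.
Qed.

(** In the crossed product [w_h w_k] is [c h k] times [w_(hk)], and units of [R] commute with the
    centraliser. In coordinates this combines three instances of the cocycle identity. *)
Lemma tactM h k a : tact (h * k)%g a = tact h (tact k a).
Proof.
apply: tco_inj => g i gi; rewrite !tco_act invMg ptactM conjgM mulrA.
congr (_ * _).
have H1 := c_cocycle h k ((g ^ h) ^ k)%g i.
have H2 := c_cocycle h (g ^ h)%g k i.
have H3 := ucocycle_stab h k gi.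
have e1 : (k * (g ^ h) ^ k = g ^ h * k)%g by rewrite (conjgC (g ^ h)%g).
have e2 : (h * g ^ h = g * h)%g by rewrite (conjgC g).
rewrite e1 in H1; rewrite e2 in H2.
have key : c (h * k)%g ((g ^ h) ^ k)%g i *
    (c g h i * c (g ^ h)%g k (h^-1%g • i)) =
    c h (g ^ h)%g i * c k ((g ^ h) ^ k)%g (h^-1%g • i) * c g (h * k)%g i.
  apply: (mulIf (ucocycle_neq0 h (g ^ h * k)%g i)); rewrite -!mulrA H2.
  transitivity (c (h * k)%g ((g ^ h) ^ k)%g i * c h (g ^ h)%g i *
    (c (g * h)%g k i * c g h i)); first by ring.
  rewrite -H3; transitivity (c (h * k)%g ((g ^ h) ^ k)%g i * c h k i *
    (c h (g ^ h)%g i * c g (h * k)%g i)); first by ring.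
  by rewrite -H1; ring.
by apply/eqP; rewrite mulf_div eqr_div ?mulf_neq0 ?ucocycle_neq0 // key.
Qed.

(** Multiplicativity of conjugation by [w_h] on [e_i w_l] and [e_i w_m], cleared of denominators; it
    serves both [tact_mul] and, with [m] the inverse of [l], [tact_star]. *)
Lemma tact_key h l m i : l • i = i ->
  c h ((l * m) ^ h)%g i * c (l ^ h)%g (m ^ h)%g (h^-1%g • i) *
    (c l h i * c m h i) =
  c h (l ^ h)%g i * c h (m ^ h)%g i * c l m i * c (l * m)%g h i.
Proof.
move=> li; have H1 := c_cocycle h (l ^ h)%g (m ^ h)%g i.
have H2 := ucocycle_stab h (m ^ h)%g li.
have H3 := ucocycle_stab m h li.
have e1 x : (h * x ^ h = x * h)%g by rewrite (conjgC x).
rewrite -conjMg e1 in H1; rewrite e1 in H2.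
rewrite [X in X * _ = _]mulrC H1.
transitivity (c (l * h)%g (m ^ h)%g i * c l h i *
  (c h (l ^ h)%g i * c m h i)); first by ring.
rewrite -H2; transitivity (c m h i * c l (m * h)%g i *
  (c h (l ^ h)%g i * c h (m ^ h)%g i)); first by ring.
by rewrite H3; ring.
Qed.

Lemma tact_mul h (a b : twisted_frob) : tact h (a * b) = tact h a * tact h b.
Proof.
apply: tco_inj => g i gi; rewrite tco_act [tco (a * b) _ _]tcoM [RHS]tcoM.
rewrite [in LHS](reindex_inj (@conjg_inj _ h)) mulr_sumr.
apply: eq_bigr => l _ /=; rewrite !tco_act -conjVg -conjMg.
have [li|li] := eqVneq (l • i) i; last first.
  rewrite (@tco_eq0 a (l ^ h)%g) ?(mul0r, mulr0) //.
  by apply: contra_neq li => /(conj_fix l h i).2.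
set m := (l^-1 * g)%g; have lm : (l * m = g)%g by rewrite mulKVg.
have key := tact_key h m li; rewrite lm in key.
have {}key : c h (g ^ h)%g i / c g h i * c (l ^ h)%g (m ^ h)%g (h^-1%g • i) =
    c h (l ^ h)%g i / c l h i * (c h (m ^ h)%g i / c m h i) * c l m i.
  apply: (mulIf (ucocycle_neq0 g h i)); apply: (mulIf (ucocycle_neq0 l h i)).
  apply: (mulIf (ucocycle_neq0 m h i)); transitivity (c h (g ^ h)%g i *
    c (l ^ h)%g (m ^ h)%g (h^-1%g • i) * (c l h i * c m h i)).
    by field; rewrite ucocycle_neq0.
  by rewrite key; field; rewrite !ucocycle_neq0.
transitivity (c h (g ^ h)%g i / c g h i * c (l ^ h)%g (m ^ h)%g (h^-1%g • i) *
  (tco a (l ^ h)%g (h^-1%g • i) * tco b (m ^ h)%g (h^-1%g • i))); first by ring.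
by rewrite key; ring.
Qed.

Lemma tact_one h : tact h 1 = 1.
Proof.
have oneE k l : tco (1 : twisted_frob) k l = (k == 1%g)%:R := tco1 k l.
apply: tco_inj => g i gi; rewrite tco_act !oneE.
have -> : ((g ^ h)%g == 1%g) = (g == 1%g) by rewrite conjg_eq1.
case: eqVneq => [->|_]; last by rewrite mulr0.
by rewrite conj1g ucocycleg1 ucocycle1g divr1 mulr1.
Qed.

Lemma tact_linear h : linear (tact h).
Proof.
move=> k a b; apply: tco_inj => g i gi; rewrite tco_act tcoD tcoZ.
by rewrite [RHS]tcoD [in RHS]tcoZ !tco_act; ring.
Qed.

Lemma tact_lambda h a : lambda (tact h a) = lambda a.
Proof.
rewrite /lambda /= /tlam (reindex_inj (can_inj (ptactK h))) /=.
apply: eq_bigr => i _; rewrite tco_act conj1g ucocycleg1 ucocycle1g ptactK.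
by rewrite lambda_idem_act divr1 mul1r.
Qed.

Lemma tact_star h a : tact h (star a) = star (tact h a).
Proof.
apply: tco_inj => g i gi; rewrite tco_act !tco_star tco_act.
have key := tact_key h g^-1%g gi.
rewrite mulgV conj1g ucocycleg1 ucocycle1g mul1r mulr1 in key.
rewrite -conjVg !rmorphM /= fmorphV /= !ucocycle_conj.
have {}key : c h (g ^ h)%g i / c g h i =
    c (g ^ h)%g (g^-1 ^ h)%g (h^-1%g • i) * c g^-1%g h i /
    (c h (g^-1 ^ h)%g i * c g g^-1%g i).
  apply/eqP; rewrite eqr_div ?mulf_neq0 ?ucocycle_neq0 //; apply/eqP.
  by rewrite -[RHS]mulrA [c _ h i * _]mulrC key; ring.
by rewrite key; field; rewrite !ucocycle_neq0.
Qed.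

Lemma tact_hom h : frob_hom (tact h).
Proof.
split; [exact: tact_linear|split|exact: tact_lambda|exact: tact_star].
  exact: tact_one.
exact: tact_mul.
Qed.

Definition twisted_action : frobAction G twisted_frob :=
  FrobAction tact_hom tact1 tactM.

Lemma tact_comp g h (a : twisted_graded) :
  a \in hcomp twisted_graded h ->
  twisted_action g a \in hcomp twisted_graded (g * h * g^-1)%g.
Proof.
move=> /tcompP a0; apply/tcompP => k i kgh; rewrite [LHS]tco_act a0 ?mulr0 //.
by apply: contra_neq kgh => <-; rewrite conjgE !mulgA mulgV mul1g mulgK.
Qed.

(** For [a] of degree [g] a single term survives on each side, and the relation is that of moving
    [w_g] past [b] by conjugation. *)
Lemma tact_cross g (a b : twisted_graded) : a \in hcomp twisted_graded g ->
  a * b = twisted_action g b * a.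
Proof.
move=> /tcompP a0; apply: tco_inj => k i ki; rewrite [LHS]tcoM [RHS]tcoM.
rewrite (big_only1 g) // => [|h hg _]; last by rewrite a0 // !mul0r.
rewrite (big_only1 (k * g^-1)%g) // => [|h hg _]; last first.
  rewrite (a0 (h^-1 * k)%g) ?mulr0 ?mul0r //; apply: contra_neq hg => <-.
  by rewrite invMg invgK mulKVg.
rewrite invMg invgK mulgVK tco_act.
have [gi|gi] := eqVneq (g • i) i; last first.
  by rewrite (@tco_eq0 a g) // !(mul0r, mulr0).
have -> : ((k * g^-1) ^ g = g^-1 * k)%g by rewrite conjgE mulgVK.
by rewrite (ptactVfix gi); field; rewrite ucocycle_neq0.
Qed.

Definition twisted_crossed : crossedFrob G C :=
  @CrossedFrob G C twisted_graded twisted_action tact_comp tact_cross.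

Definition temb (r : R) : twisted_crossed :=
  tmk (fun g i => if g == 1%g then x_ i r else 0).

Lemma tco_emb r g i : tco (temb r) g i = if g == 1%g then x_ i r else 0.
Proof.
by rewrite tcoK0 //; case: (eqVneq g 1%g) => [->|//]; rewrite ptact1 eqxx.
Qed.

Lemma temb_hom : frob_hom temb.
Proof.
split=> [k r s||r|r].
- apply: tco_inj => g i gi; rewrite [RHS]tcoD [in RHS]tcoZ !tco_emb.
  by case: ifP => _; rewrite ?coorD ?coorZ // mulr0 addr0.
- split=> [|r s]; apply: tco_inj => g i gi.
    by rewrite tco_emb [RHS]tco1 coor1; case: eqP.
  rewrite tco_emb [RHS]tcoM (big_only1 1%g) // => [|h h1 _]; last first.
    by rewrite tco_emb (negPf h1) !mul0r.
  rewrite !tco_emb eqxx invg1 mul1g ucocycle1g mulr1 coorM.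
  by case: ifP => _; rewrite ?mulr0.
- by rewrite (lambda_coor S); apply: eq_bigr => i _; rewrite tco_emb eqxx.
- apply: tco_inj => g i gi; rewrite [RHS]tco_star !tco_emb invg_eq1.
  case: eqVneq => [->|_]; last by rewrite mul0r conjC0.
  by rewrite coor_star invg1 c11 mulr1.
Qed.

Lemma temb_inj : injective temb.
Proof.
move=> r s rs; apply: (@coor_inj _ _ _ _ S) => i.
by have := congr1 (fun a : twisted => tco a 1%g i) rs; rewrite !tco_emb eqxx.
Qed.

Lemma temb_im (a : twisted_crossed) :
  a \in hcomp twisted_crossed 1%g <-> exists r, a = temb r.
Proof.
split=> [/tcompP a0|[r ->]]; last exact: (tmk_comp _ (x_ ^~ r)).
exists (of_coor (fun i => tco a 1%g i)); apply: tco_inj => g i gi.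
rewrite tco_emb of_coorK; case: eqVneq => [->//|]; exact: a0.
Qed.

Lemma temb_act g r : cact twisted_crossed g (temb r) = temb (rho g r).
Proof.
apply: tco_inj => h i hi; rewrite [LHS]tco_act !tco_emb conjg_eq1 coor_act.
case: (eqVneq h 1%g) => [->|_]; last by rewrite mulr0.
by rewrite conj1g ucocycleg1 ucocycle1g divr1 mul1r.
Qed.

Definition twisted_ext : crossedExt rho :=
  @CrossedExt G C R rho twisted_crossed temb temb_hom temb_inj temb_im temb_act.

(** The element [e_i w_g]; it is 0 when [g] moves [i], because [tmk] discards such coefficients. *)
Definition tbasis g i : twisted_ext :=
  tmk (fun h k => ((h == g) && (k == i))%:R).

Lemma tco_basis g i h k : g • i = i ->
  tco (tbasis g i) h k = ((h == g) && (k == i))%:R.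
Proof.
move=> gi; rewrite tcoK0 //; case: (eqVneq h g) => //= ->.
by case: (eqVneq k i) => //= ->; rewrite gi eqxx.
Qed.

Lemma tbasis_eq0 g i : g • i != i -> tbasis g i = 0.
Proof.
move=> gi; apply: tco_inj => h k hk; rewrite tcoK tco0 hk eqxx.
case: (eqVneq h g) => //= hg; case: (eqVneq k i) => //= ki.
by rewrite -hg -ki hk eqxx in gi.
Qed.

Lemma tbasis_fiber g i : tbasis g i \in fiber twisted_ext g i.
Proof.
have [gi|gi] := eqVneq (g • i) i; last by rewrite tbasis_eq0 // fiber0.
apply/fiberP; split.
  by apply/tcompP => h k hg; rewrite tco_basis // (negPf hg).
apply: tco_inj => h k hk; rewrite [LHS]tcoM (big_only1 h) //.
  rewrite mulVg tco_emb eqxx coor_idem ucocycleg1 mulr1 tco_basis //.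
  by case: (h == g); case: (eqVneq k i); rewrite ?mulr0 ?mulr1.
move=> l lh _; rewrite tco_emb -eq_mulVg1 (negPf lh).
by rewrite mulr0 mul0r.
Qed.

Lemma tbasis_neq0 g i : g • i = i -> tbasis g i != 0.
Proof.
move=> gi; apply/eqP => /(congr1 (fun a : twisted => tco a g i)).
by rewrite tco_basis // tco0 !eqxx => /eqP; rewrite oner_eq0.
Qed.

Lemma tbasisM g h i : g • i = i -> h • i = i ->
  tbasis g i * tbasis h i = c g h i *: tbasis (g * h)%g i.
Proof.
move=> gi hi; apply: tco_inj => k l kl; rewrite [LHS]tcoM [RHS]tcoZ.
rewrite (big_only1 g) // => [|m mg _]; last first.
  by rewrite tco_basis // (negPf mg) !mul0r.
rewrite !tco_basis ?ptactMfix // eqxx /=.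
have -> : (g^-1 * k == h)%g = (k == g * h)%g.
  by rewrite -(inj_eq (mulgI g)) mulKVg.
case: (eqVneq k (g * h)%g) => [->|_] /=; last by rewrite !(mulr0, mul0r).
by case: (eqVneq l i) => [->|_]; rewrite mulKg ?mulr1 ?mul1r ?mulr0 ?mul0r.
Qed.

Lemma tbasis_act g h i : g • i = i ->
  c (h * g * h^-1)%g h (h • i) *: cact twisted_ext h (tbasis g i) =
  c h g (h • i) *: tbasis (h * g * h^-1)%g (h • i).
Proof.
move=> gi; apply: tco_inj => k l kl; rewrite [LHS]tcoZ [RHS]tcoZ.
rewrite [X in _ * X = _](tco_act h (tbasis g i)).
rewrite !tco_basis ?ptactJfix //.
have -> : (h^-1%g • l == i) = (l == h • i).
  by apply/eqP/eqP => [<-|->]; rewrite ?ptactVK ?ptactK.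
have -> : (k ^ h == g)%g = (k == h * g * h^-1)%g.
  apply/eqP/eqP => [<-|->]; rewrite conjgE !mulgA.
    by rewrite mulgV mul1g mulgK.
  by rewrite mulVg mul1g mulgVK.
case: (eqVneq k (h * g * h^-1)%g) => [->|_] /=; last by rewrite !mulr0.
case: (eqVneq l (h • i)) => [->|_] /=; last by rewrite !mulr0.
have -> : ((h * g * h^-1) ^ h = g)%g by rewrite conjgE !mulgA mulVg mul1g mulgVK.
by field; rewrite ucocycle_neq0.
Qed.

Lemma twisted_strict : strict twisted_ext.
Proof.
apply/(strict_fibers S) => g i gi; exists (tbasis g i).
  exact: tbasis_fiber.
exact: tbasis_neq0.
Qed.

End TwistedInertia.

(** * The classification *)

Section NormalForm.
Variables (G : finGroupType) (C : numClosedFieldType) (R : frobStarAlg C).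
Variables (rho : frobAction G R) (S : spectrum rho).
Notation x_ := (coor S).
Notation "g • i" := (ptact S g i) (at level 38, right associativity).

(* Multiplying the cocycle identity over its last argument exhibits
   [|c|^#|G|] as a coboundary of positive numbers, and these have roots. *)
Lemma cocycle_norm_coboundary c : cocycle2 rho c ->
  exists n : G -> 'I_(npt S) -> C, (forall g i, 0 < n g i) /\
    forall g h i, `|x_ i (c g h)| * n (g * h)%g i = n g i * n h (g^-1%g • i).
Proof.
move=> cC; have c0 g h i : x_ i (c g h) != 0 by exact: cocycle_neq0.
pose P g i := \prod_(k : G) `|x_ i (c g k)|.
have P0 g i : 0 < P g i by rewrite prodr_gt0 // => k _; rewrite normr_gt0.
have G0 : (0 < #|G|)%N by apply/card_gt0P; exists 1%g.
have PM g h i : `|x_ i (c g h)| ^+ #|G| * P (g * h)%g i =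
    P g i * P h (g^-1%g • i).
  rewrite /P [X in _ = X * _](reindex_inj (mulgI h)).
  rewrite -big_split -prodr_const -big_split /=.
  apply: eq_bigr => k _; rewrite -!normrM mulrC -(cocycle_coor _ _ _ _ cC).
  by rewrite mulrC.
have n_gt0 g i : 0 < #|G|.-root (P g i) by rewrite rootC_gt0.
exists (fun g i => #|G|.-root (P g i)); split=> // g h i.
apply: (@pexpIrn _ #|G|) => //; rewrite ?nnegrE ?mulr_ge0 ?normr_ge0 ?ltW //.
by rewrite !exprMn !rootCK.
Qed.

Lemma cocycle_normal_form c : cocycle2 rho c -> exists d, [/\ cocycle2 rho d,
  forall g h i, x_ i (d g h) * (x_ i (d g h))^* = 1,
  forall i, x_ i (d 1%g 1%g) = 1 & cohomologous rho d c].
Proof.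
move=> cC; have c0 g h i : x_ i (c g h) != 0 by exact: cocycle_neq0.
have [n [n_gt0 nM]] := cocycle_norm_coboundary cC.
have n0 g i : n g i != 0 by rewrite gt_eqF.
have n1 i : n 1%g i = `|x_ i (c 1%g 1%g)|.
  apply: (mulIf (n0 1%g i)); have := nM 1%g 1%g i.
  by rewrite mul1g invg1 ptact1.
(* Dividing by the coboundary of [n] removes the modulus of [c]. The second factor has modulus 1, as
   [n 1 i] is the modulus of [c] at [(1, 1)], and it turns the value there into 1. *)
pose w g i := n g i * (x_ i (c 1%g 1%g) / n 1%g i).
have w0 g i : w g i != 0 by rewrite !mulf_neq0 ?invr_eq0.
have normw g i : `|w g i| = n g i.
  by rewrite normrM normf_div -n1 !gtr0_norm // divff // mulr1.
pose D g h i := x_ i (c g h) * w (g * h)%g i / (w g i * w h (g^-1%g • i)).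
have D0 g h i : D g h i != 0.
  by rewrite /D mulf_neq0 ?invr_eq0 ?mulf_neq0 ?invr_eq0 ?n0 ?c0.
exists (fun g h => of_coor (D g h)); split=> [|g h i|i|].
- apply: (cohomologous_cocycle S cC).
  exists (fun g => of_coor (fun i => (w g i)^-1)) => [g|g h].
    by apply/(is_unit_coor S) => i; rewrite of_coorK invr_eq0.
  apply: (@coor_inj _ _ _ _ S) => i; rewrite !coorM coor_act !of_coorK /D.
  by field; rewrite !w0.
- rewrite of_coorK -normCK; have -> : `|D g h i| = 1; last exact: expr1n.
  rewrite /D normf_div [`|w g i * _|]normrM [`|_ * w _ _|]normrM !normw nM.
  by rewrite divff // mulf_neq0.
- rewrite of_coorK /D /w mulg1 invg1 ptact1 mulrA; field.
  by rewrite c0 n0.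
exists (fun g => of_coor (w g)) => [g|g h].
  by apply/(is_unit_coor S) => i; rewrite of_coorK.
apply: (@coor_inj _ _ _ _ S) => i; rewrite !coorM coor_act !of_coorK /D.
by field; rewrite !w0.
Qed.

(** The crossed product is twisted by a unitary normalised representative [d], and its frame is then
    rescaled to one for [c]. *)
Lemma affords_surj c : cocycle2 rho c ->
  exists2 E : crossedExt rho, strict E & affords S E c.
Proof.
move=> /cocycle_normal_form[d [dC d_unit d11 dc]].
pose D g h i := x_ i (d g h).
have Dcoc g h k i := cocycle_coor (S := S) g h k i dC.
exists (twisted_ext (c := D) Dcoc d_unit d11).
  exact: twisted_strict.
apply: affords_cohomologous dc; exists (tbasis Dcoc d_unit d11); split.
- exact: tbasis_fiber.
- exact: tbasis_neq0.
- exact: tbasisM.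
- exact: tbasis_act.
Qed.

End NormalForm.

Lemma coboundary_cohomologous (G : finGroupType) (C : numClosedFieldType)
    (R : frobStarAlg C) (rho : frobAction G R) (S : spectrum rho)
    (c c' : G -> G -> R) :
  (exists2 b, coboundary2 rho b & forall g h, c' g h = c g h * b g h) <->
  cohomologous rho c c'.
Proof.
split=> [[b [u uU bE] c'E]|[u uU c'E]].
  by exists u => // g h; rewrite c'E -mulrA bE.
have /choice[v vE] : forall g, exists v, u g * v = 1 /\ v * u g = 1 := uU.
exists (fun g h => u g * rho g (u h) * v (g * h)%g).
  by exists u => // g h; rewrite -mulrA (vE _).2 mulr1.
by move=> g h; rewrite mulrA -c'E -mulrA (vE _).1 mulr1.
Qed.

Lemma ext_iso_refl (G : finGroupType) (C : numClosedFieldType)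
    (R : frobStarAlg C) (rho : frobAction G R) (E : crossedExt rho) :
  ext_iso E E.
Proof. by exists id; split=> //; split; [split|exists id]. Qed.

(** * Isomorphism classes of extensions against cosets of cocycles *)

Section Classification.
Variables (G : finGroupType) (C : numClosedFieldType) (R : frobStarAlg C).
Variables (rho : frobAction G R) (S : spectrum rho).

(** Collecting all afforded cocycles avoids a choice of representative or frame. *)
Definition ext_class (F : Frob rho) : set (G -> G -> R) :=
  [set c | cocycle2 rho c /\ exists2 E, sval F E & affords S E c]%classic.

Lemma Frob_repr (F : Frob rho) : exists E : strictExt rho,
  sval F = (fun E' : strictExt rho => ext_iso E E').
Proof. exact: svalP F. Qed.

(** Isomorphisms carry frames along, so a member of the class affords [c]; by [affords_unique] its
    other cocycles are cohomologous to [c], and by [affords_cohomologous] [E] affords that whole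
    class. *)
Lemma ext_class_coset (F : Frob rho) (E : strictExt rho) c :
  sval F = (fun E' : strictExt rho => ext_iso E E') ->
  cocycle2 rho c -> affords S E c ->
  ext_class F = [set c' | exists2 b, coboundary2 rho b &
                            forall g h, c' g h = c g h * b g h]%classic.
Proof.
move=> FE cC Ec; apply/seteqP; split=> c' /=.
  case=> c'C [E']; rewrite FE => EE' E'c'.
  apply/(coboundary_cohomologous S).
  exact: (affords_unique cC c'C (affords_iso EE' Ec) E'c').
move/(coboundary_cohomologous S) => cc'; split.
  exact: (cohomologous_cocycle S cC cc').
exists E; first by rewrite FE; exact: ext_iso_refl.
exact: affords_cohomologous cc'.
Qed.

Lemma ext_classP (F : Frob rho) : exists2 c, cocycle2 rho c &
  ext_class F = [set c' | exists2 b, coboundary2 rho b &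
                            forall g h, c' g h = c g h * b g h]%classic.
Proof.
have [E FE] := Frob_repr F.
have [c cC Ec] := affords_exists S (@strict_extP _ _ _ _ E).
by exists c => //; exact: ext_class_coset FE cC Ec.
Qed.

Definition Frob_to_H2 (F : Frob rho) : H2 rho := exist _ _ (ext_classP F).

(** Equal images share an afforded cocycle, and extensions that afford the same cocycle are
    isomorphic; [affords_surj] gives surjectivity. *)
Lemma Frob_to_H2_bij : bijective Frob_to_H2.
Proof.
have inj : injective Frob_to_H2.
  move=> F F' /(congr1 sval) /= FF'; apply: eq_sig_hprop => [? ? ?|].
    exact: Prop_irrelevance.
  have [E FE] := Frob_repr F; have [E' FE'] := Frob_repr F'.
  have [c cC Ec] := affords_exists S (@strict_extP _ _ _ _ E).
  have : ext_class F c.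
    by split=> //; exists E => //; rewrite FE; exact: ext_iso_refl.
  rewrite FF' => -[_ [E1]]; rewrite FE' => E'E1 E1c.
  (* The isomorphism carries frames from [E'] to [E1]. To see that [E'] affords [c], one of its
     cocycles [c'] is compared with [c] over [E1], and the frame of [E'] is rescaled. *)
  have [c' c'C E'c'] := affords_exists S (@strict_extP _ _ _ _ E').
  have c'c := affords_unique c'C cC (affords_iso E'E1 E'c') E1c.
  have E'c := affords_cohomologous E'c' c'c.
  rewrite FE; apply: funext => E2; apply: propext; split=> EE2.
    exact: affords_ext_iso cC E'c (affords_iso EE2 Ec).
  exact: affords_ext_iso cC Ec (affords_iso EE2 E'c).
have /choice[f fK] : forall H : H2 rho, exists F, Frob_to_H2 F = H.
  move=> H; case: (svalP H) => c cC HE; have [E Es Ec] := affords_surj S cC.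
  pose Es' := StrictExt Es.
  pose F : Frob rho :=
    exist _ (fun E' : strictExt rho => ext_iso Es' E') (ex_intro _ Es' erefl).
  exists F; apply: eq_sig_hprop => [? ? ?|]; first exact: Prop_irrelevance.
  rewrite HE /=.
  exact: (@ext_class_coset F Es' c).
by exists f => // F; apply: inj; rewrite fK.
Qed.

End Classification.

Theorem theorem1p1 (K : realType) (G : finGroupType) (R : frobStarAlg K[i])
    (R_comm : forall a b : R, a * b = b * a) (rho : frobAction G R) :
  exists Phi : Frob rho -> H2 rho, bijective Phi.
Proof.
have [S] := spectrum_exists rho R_comm.
by exists (Frob_to_H2 S); exact: Frob_to_H2_bij.
Qed.
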